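(* Let $\alpha\in[0,1/2)$ be arbitrary and let $k\ge3$ be an integer. Let $K$ be an upper bound for the sub-Gaussian norm of a standard Gaussian random variable. There exist constants $C=C(k,K)>0$, $c_K>0$ depending only on $K$, and $c_4=c_4(k,\alpha,K)>0$ such that the following holds. Let $\delta>0$ and let $x\in\mathbb{R}^N$ be a fixed $k$-sparse vector with support $T=\mathrm{supp}(x)$, $\#T=k$, such that $\min_{j\in T}|x_j|\ge C\delta$. Suppose that $\Phi\in\mathbb{R}^{m\times N}$ is a Gaussian matrix (its entries are i.i.d. standard Gaussian) and that $\lambda=m/k\ge c_4\log N$. Let $x_{\rm MSQ}$ be obtained from $q=Q(\Phi x)$ using the two-stage method. Then there are constants $c_5,c_6,c_7>0$ that depend only on $k$, $K$ and $x$ such that, with probability at least $1-c_5\exp(-c_6\lambda^\alpha)$ on the draw of $\Phi$, the reconstruction error satisfies $$\|x_{\rm MSQ}-x\|\le A\left(2\|x\|\exp\Big(-\frac{2\pi^2\|x\|^2}{\delta^2}\Big)+c_7\sqrt{\log k}\,\lambda^{-(1-\alpha)/2}\delta\right),$$ where $A=(1/2-c_K\lambda^{-1/2})^{-2}$.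
   Context: $\|\cdot\|$ is the Euclidean norm. For $\delta>0$, the uniform scalar quantizer $q_\delta:\mathbb{R}\to\delta\mathbb{Z}$ is $q_\delta(t)=n\delta$ if $t\in(n\delta-\delta/2,\,n\delta+\delta/2]$, $n\in\mathbb{Z}$; $Q=Q_\delta^{\rm MSQ}:\mathbb{R}^m\to(\delta\mathbb{Z})^m$ applies $q_\delta$ to each coordinate. A vector is $k$-sparse if it has at most $k$ nonzero entries. For $T\subset\{1,\dots,N\}$, $\Phi_T$ is the submatrix of $\Phi$ consisting of the columns indexed by $T$. $M^\dagger$ is the Moore–Penrose pseudoinverse of $M$. The sub-Gaussian norm of a real random variable $z$ is $\|z\|_{\psi_2}=\sup_{p\ge1}p^{-1/2}(\mathbb{E}|z|^p)^{1/p}$. Two-stage method: given $q=Q(\Phi x)$. Stage 1: let $x^\#$ be a solution of: minimize $\|z\|_1$ over $z\in\mathbb{R}^N$ subject to $\|\Phi z-q\|\le\sqrt m\,\delta/2$; let $\widehat T$ be the set of indices of the $k$ largest-in-magnitude entries of $x^\#$. Stage 2: $x_{\rm MSQ}$ is the vector supported on $\widehat T$ whose restriction to $\widehat T$ is $\Phi_{\widehat T}^\dagger q$. *)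

(* Defs.v *)
From HB Require Import structures.
From mathcomp Require Import all_boot all_order all_algebra.
From mathcomp Require Import all_classical all_reals all_analysis.
From mathcomp Require Import lra.

Set Implicit Arguments.
Unset Strict Implicit.
Unset Printing Implicit Defensive.

Import Order.TTheory GRing.Theory Num.Theory.
Import numFieldNormedType.Exports.

Local Open Scope classical_set_scope.
Local Open Scope ring_scope.

Definition subgaussian_norm d (T : measurableType d) (R : realType)
    (P : probability T R) (z : {RV P >-> R}) : \bar R :=
  ereal_sup [set ((p `^ (- 2^-1))%:E * Lnorm P p%:E (EFin \o z))%E
            | p in [set p : R | 1 <= p]].

Definition standard_gaussian d (T : measurableType d) (R : realType)
    (P : probability T R) (z : {RV P >-> R}) : Prop :=
  forall B : set R, measurable B -> distribution P z B = normal_prob 0 1 B.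

Definition idR (R : realType) : measurableTypeR R -> R := idfun.

HB.instance Definition _ (R : realType) :=
  @isMeasurableFun.Build _ _ _ _ (@idR R) (@measurable_id _ _ setT).

Definition std_gaussian (R : realType) : {RV normal_prob (0 : R) 1 >-> R} :=
  @idR R.

Lemma std_gaussianP (R : realType) : standard_gaussian (std_gaussian R).
Proof. by []. Qed.

Definition mutually_independent d (T : measurableType d) (R : realType)
    (P : probability T R) (I : finType) (X : I -> {RV P >-> R}) : Prop :=
  forall (J : {set I}) (B : I -> set R),
    (forall i, i \in J -> measurable (B i)) ->
    P (\bigcap_(i in [set` J]) (X i @^-1` B i)) =
    (\prod_(i in J) P (X i @^-1` B i))%E.

Definition gaussian_matrix d (T : measurableType d) (R : realType)
    (P : probability T R) (m N : nat) (Phi : 'I_m -> 'I_N -> {RV P >-> R}) :=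
  (forall i j, standard_gaussian (Phi i j)) /\
  mutually_independent (fun ij : 'I_m * 'I_N => Phi ij.1 ij.2).

Definition draw d (T : measurableType d) (R : realType)
    (P : probability T R) (m N : nat) (Phi : 'I_m -> 'I_N -> {RV P >-> R})
    (w : T) : 'M[R]_(m, N) :=
  \matrix_(i, j) Phi i j w.

(* The library norm on matrices is the sup norm. *)
Definition norm2 (R : realType) (n : nat) (v : 'cV[R]_n) : R :=
  Num.sqrt (\sum_(i < n) v i 0 ^+ 2).

Definition norm1 (R : realType) (n : nat) (v : 'cV[R]_n) : R :=
  \sum_(i < n) `|v i 0|.

Definition supp (R : realType) (n : nat) (v : 'cV[R]_n) : {set 'I_n} :=
  [set i | v i 0 != 0]%SET.

Definition sparse (R : realType) (n k : nat) (v : 'cV[R]_n) : Prop :=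
  (#|supp v| <= k)%N.

Definition restrict (R : realType) (n : nat) (S : {set 'I_n}) (v : 'cV[R]_n) :
    'cV[R]_#|S| :=
  \col_(i < #|S|) v (enum_val i) 0.

Definition columns (R : realType) (m n : nat) (S : {set 'I_n})
    (M : 'M[R]_(m, n)) : 'M[R]_(m, #|S|) :=
  \matrix_(i < m, j < #|S|) M i (enum_val j).

Definition penrose (R : realType) (m n : nat) (M : 'M[R]_(m, n))
    (X : 'M[R]_(n, m)) : Prop :=
  [/\ M *m X *m M = M, X *m M *m X = X,
      (M *m X)^T = M *m X & (X *m M)^T = X *m M].

(* Total: a matrix satisfying the Penrose equations always exists, see
   mp_pinvP, and is unique, see penrose_uniq. *)
Definition mp_pinv (R : realType) (m n : nat) (M : 'M[R]_(m, n)) :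
    'M[R]_(n, m) :=
  xget 0 [set X | penrose M X].

Lemma penrose_uniq (R : realType) (m n : nat) (M : 'M[R]_(m, n))
    (X Y : 'M[R]_(n, m)) :
  penrose M X -> penrose M Y -> X = Y.
Proof.
move=> [X1 X2 X3 X4] [Y1 Y2 Y3 Y4].
have MXY : M *m X = M *m Y.
  rewrite -X3 -{1}Y1 -(mulmxA (M *m Y)) trmx_mul X3 Y3.
  by rewrite mulmxA X1.
have XYM : X *m M = Y *m M.
  rewrite -X4 -{1}Y1 !mulmxA -(mulmxA (X *m M)) trmx_mul X4 Y4.
  by rewrite -!mulmxA (mulmxA M X M) X1.
by rewrite -X2 XYM -mulmxA MXY mulmxA Y2.
Qed.

Lemma gram_unit (R : realType) (m r : nat) (B : 'M[R]_(m, r)) :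
  \rank B = r -> B^T *m B \in unitmx.
Proof.
move=> rB; rewrite -row_free_unit -kermx_eq0; apply/eqP/row_matrixP => i.
rewrite row0; set u := row i _.
have uBB : u *m B^T *m B = 0.
  rewrite -mulmxA; apply/sub_kermxP.
  exact: row_sub.
have uB : u *m B^T = 0.
  apply/rowP => j; rewrite [RHS]mxE.
  have : (u *m B^T *m B *m u^T) 0 0 = 0 by rewrite uBB mul0mx mxE.
  rewrite -(mulmxA (u *m B^T)) -{2}(trmxK B) -trmx_mul mxE => /eqP.
  rewrite psumr_eq0 => [/allP/(_ j (mem_index_enum _))/implyP/(_ isT)|l _].
    by rewrite [X in _ * X]mxE mulf_eq0 orbb => /eqP.
  by rewrite [X in _ * X]mxE -expr2 sqr_ge0.
have : row_free B^T by rewrite /row_free mxrank_tr rB.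
by move/row_free_inj => inj; apply: inj; rewrite uB mul0mx.
Qed.

Lemma mp_pinvP (R : realType) (m n : nat) (M : 'M[R]_(m, n)) :
  penrose M (mp_pinv M).
Proof.
suff [X MX] : exists X, penrose M X
  by rewrite /mp_pinv; case: xgetP => // /(_ X).
have [r [B [C [<- rB rC]]]] : exists r (B : 'M[R]_(m, r)) (C : 'M[R]_(r, n)),
    [/\ B *m C = M, \rank B = r & \rank C = r].
  exists (\rank M), (col_base M), (row_base M); split.
  - exact: mulmx_base.
  - by apply/eqP; have := col_base_full M.
  - by apply/eqP; have := row_base_free M.
have uB : B^T *m B \in unitmx by exact: gram_unit.
have uC : C *m C^T \in unitmx.
  by have := @gram_unit _ _ _ C^T; rewrite trmxK mxrank_tr; apply.
set b := invmx (B^T *m B); set c := invmx (C *m C^T).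
have bT : b^T = b by rewrite /b trmx_inv trmx_mul trmxK.
have cT : c^T = c by rewrite /c trmx_inv trmx_mul trmxK.
pose X := C^T *m c *m b *m B^T.
have MX : B *m C *m X = B *m b *m B^T.
  have -> : B *m C *m X = B *m (C *m C^T *m c) *m b *m B^T by rewrite !mulmxA.
  by rewrite mulmxV ?mulmx1.
have XM : X *m (B *m C) = C^T *m c *m C.
  have -> : X *m (B *m C) = C^T *m c *m (b *m (B^T *m B)) *m C.
    by rewrite !mulmxA.
  by rewrite mulVmx ?mulmx1.
exists X; split.
- rewrite MX.
  have -> : B *m b *m B^T *m (B *m C) = B *m (b *m (B^T *m B)) *m C.
    by rewrite !mulmxA.
  by rewrite mulVmx ?mulmx1.
- rewrite XM.
  have -> : C^T *m c *m C *m X = C^T *m (c *m (C *m C^T)) *m c *m b *m B^T.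
    by rewrite !mulmxA.
  by rewrite mulVmx ?mulmx1.
- by rewrite MX !trmx_mul trmxK bT mulmxA.
- by rewrite XM !trmx_mul trmxK cT mulmxA.
Qed.

Definition quantizer (R : realType) (delta t : R) : R :=
  (Num.ceil (t / delta - 2^-1))%:~R * delta.

Lemma quantizerP (R : realType) (delta t : R) (n : int) : 0 < delta ->
  n%:~R * delta - delta / 2 < t <= n%:~R * delta + delta / 2 ->
  quantizer delta t = n%:~R * delta.
Proof.
move=> d0 /andP[lt le]; rewrite /quantizer; congr (_%:~R * _).
apply: ceil_def; rewrite intrD mulrN1z; apply/andP; split.
  rewrite -(ltr_pM2r d0) !mulrBl divfK ?gt_eqF//; lra.
rewrite -(ler_pM2r d0) mulrBl divfK ?gt_eqF//; lra.
Qed.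

Definition msq (R : realType) (m : nat) (delta : R) (y : 'cV[R]_m) :
    'cV[R]_m :=
  map_mx (quantizer delta) y.

Definition l1_solution (R : realType) (m N : nat) (Phi : 'M[R]_(m, N))
    (q : 'cV[R]_m) (delta : R) (z : 'cV[R]_N) : Prop :=
  let feasible u := norm2 (Phi *m u - q) <= Num.sqrt m%:R * delta / 2 in
  feasible z /\ forall u, feasible u -> norm1 z <= norm1 u.

(* S consists of the indices of the k largest-in-magnitude entries of z
   (not unique in case of ties). *)
Definition largest_entries (R : realType) (N k : nat) (z : 'cV[R]_N)
    (S : {set 'I_N}) : Prop :=
  #|S| = k /\ forall i j, i \in S -> j \notin S -> `|z j 0| <= `|z i 0|.

(* A relation rather than a function, since neither the minimizer nor the set
   of largest entries need be unique. *)
Definition two_stage (R : realType) (m N k : nat) (delta : R)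
    (Phi : 'M[R]_(m, N)) (q : 'cV[R]_m) (xMSQ : 'cV[R]_N) : Prop :=
  exists (xs : 'cV[R]_N) (S : {set 'I_N}),
    [/\ l1_solution Phi q delta xs,
        largest_entries k xs S,
        supp xMSQ \subset S &
        restrict S xMSQ = mp_pinv (columns S Phi) *m q].

(* Main.v *)
(* The dimension N and the signal x are fixed before m, so for large lambda the
   Gram matrix of all N columns of Phi is close to m times the identity with
   overwhelming probability. This makes stage 1 elementary: both x and the l1
   minimizer are feasible, hence within 2 delta of each other, and the support
   is recovered. In stage 2 the normal equations bound the error e by the
   correlation of the columns of Phi with the quantization residual, which is
   delta times a sawtooth of <phi_i, x> / delta. Expanding the sawtooth in a
   Fourier series, E [g sin (a g)] = a exp (- a^2 / 2) gives the mean correlation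
   2 |x_j| sum_(n >= 1) exp (- 2 pi^2 n^2 |x|^2 / delta^2); its first term is the
   main term of the bound, and the others are absorbed by A >= 4. The fluctuations
   around the mean and the Gram matrix are controlled by a Chernoff bound, the
   former at scale t = lambda^(- (1 - alpha) / 2), where
   m t^2 = k lambda^alpha. *)
Require Import Defs.
From HB Require Import structures.
From mathcomp Require Import all_boot all_order all_algebra.
From mathcomp Require Import all_classical all_reals all_analysis.
From mathcomp Require Import measurable_realfun ring lra.

Set Implicit Arguments.
Unset Strict Implicit.
Unset Printing Implicit Defensive.

Import Order.TTheory GRing.Theory Num.Theory.
Import numFieldNormedType.Exports.

Local Open Scope classical_set_scope.
Local Open Scope ring_scope.

(** The law of <phi_i, x> is never identified. Its trigonometric expectations are computed one
    coordinate at a time, from addition formulas, independence of disjoint blocks of entries, and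
    the integrals of cos (a g + t) and g sin (a g + t) for a single Gaussian g; carrying a phase t
    lets one formula serve sine and cosine. The sawtooth is discontinuous, so its Fourier series
    represents it only off the jumps and does not converge absolutely. Truncated Abel means are
    finite trigonometric sums bounded by 1, which permits dominated convergence; that the jumps have
    probability zero is itself read off from the cosine expectations, with no recourse to a density.
    Concentration uses independence of the rows only: each summand is dominated by squares of
    entries of its row, so E exp (g^2 / 4) controls its exponential moments. The function exp (x^2 /
    4) also serves as the dominating function for the Gaussian integrals. Bounded lambda is disposed
    of by a large [c5], which makes the probability bound void there; beyond that range A >= 4
    leaves room for all numerical losses. *)

(** * Integrability of real-valued functions *)

Section integrable_EFin.
Context d (T : measurableType d) (R : realType).
Variable mu : {measure set T -> \bar R}.
Implicit Types f g : T -> R.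
Local Notation integrableR f := (mu.-integrable setT (EFin \o f)).

Lemma integrableR_measurable f : integrableR f -> measurable_fun setT f.
Proof. by move=> fi; apply/measurable_EFinP; exact: measurable_int fi. Qed.

Lemma integrableR_Z (k : R) f : integrableR f ->
  integrableR (fun x => k * f x).
Proof. exact: (integrableZl measurableT k). Qed.

Lemma integrableR_D f g : integrableR f -> integrableR g ->
  integrableR (fun x => f x + g x).
Proof. exact: (integrableD measurableT). Qed.

Lemma integrableR_B f g : integrableR f -> integrableR g ->
  integrableR (fun x => f x - g x).
Proof. exact: (integrableB measurableT). Qed.

Lemma integrableR_le f g : measurable_fun setT f ->
  (forall x, `|f x| <= g x) -> integrableR g -> integrableR f.
Proof.
move=> mf fg; apply: (le_integrable measurableT).
  exact/measurable_EFinP.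
by move=> x _ /=; rewrite lee_fin (le_trans (fg x))// ler_norm.
Qed.

Lemma integrableR_sum (I : Type) (r : seq I) (Q : pred I) (F : I -> T -> R) :
  (forall i, Q i -> integrableR (F i)) ->
  integrableR (fun x => \sum_(i <- r | Q i) F i x).
Proof.
move=> Fi; elim: r => [|i r IH].
  apply: (eq_integrable measurableT (cst 0%E)) => [x _ /=|]; last exact: integrable0.
  by rewrite big_nil.
case: (boolP (Q i)) => Qi.
  apply: (eq_integrable measurableT (EFin \o (fun x => F i x + \sum_(j <- r | Q j) F j x))).
    by move=> x _ /=; rewrite big_cons Qi.
  by apply: integrableR_D => //; exact: Fi.
apply: (eq_integrable measurableT _ _ _ IH).
by move=> x _ /=; rewrite big_cons (negbTE Qi).
Qed.

Lemma Rintegral_sum (I : Type) (r : seq I) (Q : pred I) (F : I -> T -> R) :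
  (forall i, Q i -> integrableR (F i)) ->
  \int[mu]_x (\sum_(i <- r | Q i) F i x) = \sum_(i <- r | Q i) \int[mu]_x F i x.
Proof.
move=> Fi; elim: r => [|i r IH].
  rewrite big_nil; under eq_Rintegral do rewrite big_nil.
  by rewrite Rintegral_cst//= mul0r.
rewrite big_cons; under eq_Rintegral do rewrite big_cons.
case: (boolP (Q i)) => Qi //.
by rewrite RintegralD//; [rewrite IH|exact: Fi|exact: integrableR_sum].
Qed.

End integrable_EFin.

Lemma integrableR_bounded d (T : measurableType d) (R : realType)
    (P : probability T R) (f : T -> R) (c : R) :
  measurable_fun setT f -> (forall x, `|f x| <= c) ->
  P.-integrable setT (EFin \o f).
Proof.
move=> mf fc; apply: (integrableR_le (g := fun=> c)) => //.
exact: finite_measure_integrable_cst.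
Qed.

(** * Independence *)

Section independence.
Local Open Scope ereal_scope.
Context d (T : measurableType d) (R : realType) (P : probability T R).

(** Dynkin's theorem in one argument: for fixed [B], the sets that factorise with [B] form a
    lambda-system. The other argument follows by symmetry in [indep_sigma]. *)
Let indep_sigma_l (G : set (set T)) (B : set T) :
  setI_closed G -> G `<=` measurable -> measurable B ->
  (forall A, G A -> P (A `&` B) = P A * P B) ->
  forall A, <<s G >> A -> P (A `&` B) = P A * P B.
Proof.
move=> GI Gm mB GB.
pose H := [set A | measurable A /\ P (A `&` B) = P A * P B].
suff : <<s G >> `<=` H by move=> GH A /GH[].
apply: lambda_system_subset => //; last first.
  by move=> A GA; split; [exact: Gm|exact: GB].
apply/dynkin_lambda_system; split.
- by split => //; rewrite setTI probability_setT mul1e.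
- move=> A [mA AB]; split; first exact: measurableC.
  have E : P (B `\` A) = P B - P (A `&` B).
    rewrite setIC; apply: measureD => //.
    by rewrite (le_lt_trans (probability_le1 _ _))// ltry.
  rewrite setIC -setDE E AB probability_setC// muleBl ?mul1e//.
  exact: fin_num_measure.
- move=> F tF HF; have mF n : measurable (F n) by have [] := HF n.
  split; first exact: bigcup_measurable.
  rewrite setI_bigcupl measure_bigcup//; first last.
  + by apply: trivIset_setIr.
  + by move=> n _; exact: measurableI.
  rewrite measure_bigcup// muleC -(fineK (fin_num_measure P B mB)) -nneseriesZl//.
  by apply: eq_eseriesr => n _; rewrite fineK ?fin_num_measure// muleC; have [_ <-] := HF n.
Qed.

Lemma indep_sigma (G1 G2 : set (set T)) :
  setI_closed G1 -> setI_closed G2 ->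
  G1 `<=` measurable -> G2 `<=` measurable ->
  (forall A B, G1 A -> G2 B -> P (A `&` B) = P A * P B) ->
  forall A B, <<s G1 >> A -> <<s G2 >> B -> P (A `&` B) = P A * P B.
Proof.
move=> I1 I2 m1 m2 G12 A B sA sB.
have mB : measurable B.
  by apply: (@smallest_sub _ _ _ _ _ m2) sB; exact: sigma_algebra_measurable.
apply: (@indep_sigma_l G1) => // {A sA}A GA.
rewrite setIC muleC; apply: (@indep_sigma_l G2) => //; first exact: m1.
by move=> B' GB'; rewrite setIC muleC G12.
Qed.

End independence.

(** A pi-system generating the sigma-algebra of the variables in [J]. The family [B] is indexed by
    all of [I] to avoid a dependent index; only its values on [J] matter. *)
Definition cylinder d (T : measurableType d) (R : realType)
    (P : probability T R) (I : finType) (X : I -> {RV P >-> R})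
    (J : {set I}) : set (set T) :=
  [set A | exists2 B : I -> set R, (forall i, measurable (B i)) &
             A = \bigcap_(i in [set` J]) (X i @^-1` B i)].

(** Phrased as measurability for the generated sigma-algebra, so that stability under sums, products
    and compositions comes from the general measurability lemmas. *)
Definition depends_on d (T : measurableType d) (R : realType)
    (P : probability T R) (I : finType) (X : I -> {RV P >-> R})
    (J : {set I}) (f : T -> R) : Prop :=
  measurable_fun setT (f : g_sigma_algebraType (cylinder X J) -> R).

Section blocks.
Local Open Scope ereal_scope.
Context d (T : measurableType d) (R : realType) (P : probability T R).
Context (I : finType) (X : I -> {RV P >-> R}).

Lemma cylinderI J : setI_closed (cylinder X J).
Proof.
move=> _ _ [B mB ->] [B' mB' ->]; exists (fun i => B i `&` B' i).
  by move=> i; exact: measurableI.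
by rewrite -bigcapI; apply: eq_bigcapr => i _; rewrite preimage_setI.
Qed.

Lemma cylinder_measurable J : cylinder X J `<=` measurable.
Proof.
move=> _ [B mB ->]; apply: fin_bigcap_measurable => //.
by move=> i _; exact: measurable_funPTI.
Qed.

Lemma cylinderS (J J' : {set I}) : (J \subset J')%SET ->
  cylinder X J `<=` cylinder X J'.
Proof.
move=> JJ' _ [B mB ->]; exists (fun i => if i \in J then B i else setT).
  by move=> i; case: ifP.
apply/seteqP; split => w /= Xw i /= iJ'.
  by case: ifP => // /Xw.
by have /= := Xw i (fintype.subsetP JJ' _ iJ'); rewrite iJ'.
Qed.

(** Mutual independence gives the product formula on cylinders, and the two pi-systems carry it to
    the generated sigma-algebras. *)
Lemma indep_blocks (J J' : {set I}) : mutually_independent X ->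
  (forall i, i \in J -> i \notin J') -> forall A B,
  <<s cylinder X J >> A -> <<s cylinder X J' >> B ->
  P (A `&` B) = P A * P B.
Proof.
move=> iX JJ'; apply: indep_sigma;
  [exact: cylinderI|exact: cylinderI|exact: cylinder_measurable|
   exact: cylinder_measurable|].
move=> _ _ [B mB ->] [B' mB' ->].
(* Disjointness of [J] and [J'] merges the two families of constraints into a single one over the
   union. *)
pose C i := if i \in J then B i else B' i.
have mC i : measurable (C i) by rewrite /C; case: ifP.
have J'N i : i \in J' -> i \in J = false.
  by move=> iJ'; apply/negbTE; apply/negP => /JJ'; rewrite iJ'.
have -> : \bigcap_(i in [set` J]) (X i @^-1` B i) `&`
          \bigcap_(i in [set` J']) (X i @^-1` B' i) =
          \bigcap_(i in [set` (J :|: J')%SET]) (X i @^-1` C i).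
  apply/seteqP; split => [w [/= Jw J'w] i /=|w Cw].
    rewrite inE /C; case: ifPn => [iJ _|_ /=]; first exact: Jw.
    exact: J'w.
  split => i /= iJ.
    by have /= := Cw i; rewrite inE iJ /C iJ; apply.
  by have /= := Cw i; rewrite inE iJ /C (J'N _ iJ) orbT; apply.
rewrite !iX//; try by move=> i _.
rewrite (bigID (fun i => i \in J))/=; congr (_ * _).
  rewrite (eq_bigl (fun i => i \in J)) => [|i]; last first.
    by rewrite inE; case: (i \in J); rewrite ?andbF.
  by apply: eq_bigr => i iJ; rewrite /C iJ.
rewrite (eq_bigl (fun i => i \in J')) => [|i]; last first.
  rewrite inE; case: (boolP (i \in J')) => [/J'N ->//|_].
  by rewrite orbF andbN.
by apply: eq_bigr => i iJ; rewrite /C J'N.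
Qed.

Lemma depends_on_sigma J f (B : set R) : depends_on X J f -> measurable B ->
  <<s cylinder X J >> (f @^-1` B).
Proof. by move=> mf mB; have := mf measurableT B mB; rewrite setTI. Qed.

Lemma depends_on_measurable J f : depends_on X J f -> measurable_fun setT f.
Proof.
move=> mf _ B mB; rewrite setTI.
have := depends_on_sigma mf mB; apply: smallest_sub.
  exact: sigma_algebra_measurable.
exact: cylinder_measurable.
Qed.

Lemma depends_onS (J J' : {set I}) f : (J \subset J')%SET ->
  depends_on X J f -> depends_on X J' f.
Proof.
move=> JJ' mf _ B mB; rewrite setTI.
have := depends_on_sigma mf mB; apply: smallest_sub.
  exact: smallest_sigma_algebra.
by move=> A /(cylinderS JJ'); exact: sub_sigma_algebra.
Qed.

Lemma depends_on_var (J : {set I}) i : i \in J -> depends_on X J (X i).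
Proof.
move=> iJ _ B mB; rewrite setTI; apply: sub_sigma_algebra.
exists (fun j => if j == i then B else setT) => [j|]; first by case: ifP.
apply/seteqP; split => w /=; first by move=> Bw j /= _; case: eqP => // ->.
by move=> /(_ _ iJ); rewrite eqxx.
Qed.

End blocks.

(** * Expectation of a product of independent variables *)

Section expectation_product.
Local Open Scope ereal_scope.
Context d (T : measurableType d) (R : realType) (P : probability T R).
Variables (f g : T -> R).
Hypothesis fg : forall A B : set R, measurable A -> measurable B ->
  P (f @^-1` A `&` g @^-1` B) = P (f @^-1` A) * P (g @^-1` B).
Hypothesis intf : P.-integrable setT (EFin \o f).
Hypothesis intg : P.-integrable setT (EFin \o g).

Let mf : measurable_fun setT f.
Proof. by apply/measurable_EFinP; exact: measurable_int intf. Qed.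
Let mg : measurable_fun setT g.
Proof. by apply/measurable_EFinP; exact: measurable_int intg. Qed.
Let F : {mfun T >-> R} := HB.pack f (isMeasurableFun.Build _ _ _ _ f mf).
Let G : {mfun T >-> R} := HB.pack g (isMeasurableFun.Build _ _ _ _ g mg).
Let h w := (f w, g w).
Let mh : measurable_fun setT h.
Proof. exact: measurable_fun_pair. Qed.
Let H : {mfun T >-> (R * R)%type} :=
  HB.pack h (isMeasurableFun.Build _ _ _ _ h mh).

(** Independence is this identity on rectangles, and a product measure is determined by its values
    there. *)
Let jointE (A : set (R * R)) : measurable A ->
  distribution P H A = (distribution P F \x distribution P G) A.
Proof.
move=> mA; by apply/esym/product_measure_unique => // B C mB mC; exact: fg.
Qed.

Let mprod : measurable_fun setT (fun z : R * R => (z.1 * z.2)%:E).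
Proof. by apply/measurable_EFinP; exact: measurable_funM. Qed.

Let integrable_joint : (distribution P F \x distribution P G).-integrable setT
  (fun z : R * R => (z.1 * z.2)%:E).
Proof.
have mabs : measurable_fun setT (fun y : R => `|y|%:E).
  by apply/measurable_EFinP; exact: normr_measurable.
apply/integrable12ltyP => //=.
have Ef : \int[distribution P F]_x `|x|%:E < +oo.
  by rewrite ge0_integral_distribution//=; case/integrableP: intf.
have Eg : \int[distribution P G]_x `|x|%:E < +oo.
  by rewrite ge0_integral_distribution//=; case/integrableP: intg.
under eq_integral => x _.
  under eq_integral => y _ do rewrite normrM EFinM.
  rewrite ge0_integralZl//=.
  over.
rewrite ge0_integralZr//=; last by apply: integral_ge0.
by rewrite lte_mul_pinfty// ?integral_ge0// ge0_fin_numE ?integral_ge0.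
Qed.

(** A product of integrable functions need not be integrable; here Tonelli on the product law bounds
    it by E|f| E|g|. *)
Lemma integrable_indepM : P.-integrable setT (EFin \o (fun w => f w * g w)%R).
Proof.
apply/integrableP; split; first by apply/measurable_EFinP; exact: measurable_funM.
have /integrableP[_] := integrable_joint.
rewrite (eq_measure_integral (distribution P H)) => [|A mA _]; last first.
  exact/esym/jointE.
by rewrite ge0_integral_distribution//; exact: measurableT_comp.
Qed.

Lemma Rintegral_indepM :
  (\int[P]_w (f w * g w) = \int[P]_w f w * \int[P]_w g w)%R.
Proof.
rewrite {1}/Rintegral.
have -> : \int[P]_w (f w * g w)%:E =
          \int[distribution P F \x distribution P G]_z (z.1 * z.2)%:E.
  rewrite (eq_measure_integral (distribution P H)) => [|A mA _]; last first.
    exact/esym/jointE.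
  by rewrite integral_distribution//; exact: integrable_indepM.
rewrite -(integral12_prod_meas1 integrable_joint).
have ig : (distribution P G).-integrable setT (EFin : R -> \bar R).
  by apply: integrable_pushforward.
have if_ : (distribution P F).-integrable setT (EFin : R -> \bar R).
  by apply: integrable_pushforward.
have Eg : \int[distribution P G]_y y%:E = (\int[P]_w g w)%R%:E.
  rewrite integral_distribution// fineK//; exact: integrable_fin_num.
have Ef : \int[distribution P F]_y y%:E = (\int[P]_w f w)%R%:E.
  rewrite integral_distribution// fineK//; exact: integrable_fin_num.
rewrite (eq_integral (fun x : R => x%:E * ((\int[P]_w g w)%R)%:E)) => [|x _]; last first.
  rewrite /fubini_F -Eg -integralZl//=.
by rewrite integralZr// Ef.
Qed.

End expectation_product.

(** * Gaussian integrals *)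

Section gaussian.
Context (R : realType).
Local Notation mu := (@lebesgue_measure R).
Local Notation pdf := (@normal_pdf R 0 1).
Local Notation gamma := (@normal_prob R 0 1).

Lemma std_normal_pdfE x : pdf x = normal_peak 1 * expR (- (x ^+ 2 / 2)).
Proof.
rewrite normal_pdfE ?oner_neq0// /normal_fun subr0 expr1n.
by rewrite mulNr.
Qed.

(** The Radon-Nikodym derivative of [gamma] and [pdf] have the same integral over every measurable
    set, hence agree almost everywhere. *)
Lemma ge0_integral_std_normal (f : R -> \bar R) :
  measurable_fun setT f -> (forall x, (0 <= f x)%E) ->
  (\int[gamma]_x f x = \int[mu]_x (f x * (pdf x)%:E))%E.
Proof.
move=> mf f0.
have dom : gamma `<< mu by exact: normal_prob_dominates.
rewrite -(Radon_Nikodym_SigmaFinite.change_of_variables dom)//.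
apply: ae_eq_integral => //.
- apply: emeasurable_funM => //.
  exact: (measurable_int mu (Radon_Nikodym_SigmaFinite.f_integrable dom)).
- apply: emeasurable_funM => //; apply/measurable_EFinP.
  exact: measurable_normal_pdf.
- apply: ae_eqe_mul2l => /=; apply: integral_ae_eq => //.
  + exact: Radon_Nikodym_SigmaFinite.f_integrable.
  + by apply/measurable_EFinP; exact: measurable_normal_pdf.
  + by move=> E _ mE; rewrite -Radon_Nikodym_SigmaFinite.f_integral.
Qed.

Lemma integrable_std_normalP (f : R -> R) : measurable_fun setT f ->
  gamma.-integrable setT (EFin \o f) <->
  mu.-integrable setT (EFin \o (fun x => f x * pdf x)).
Proof.
move=> mf.
have mf' : measurable_fun setT (fun x : R => (`|f x|%:E)%E).
  by apply/measurable_EFinP; exact: measurableT_comp.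
have E : (\int[gamma]_x `|f x|%:E = \int[mu]_x `|f x * pdf x|%:E)%E.
  rewrite ge0_integral_std_normal//.
  by apply: eq_integral => x _; rewrite normrM EFinM [`|pdf x|]ger0_norm// normal_pdf_ge0.
have mfp : measurable_fun setT (fun x => f x * pdf x).
  by apply: measurable_funM => //; exact: measurable_normal_pdf.
split => /integrableP[_ fi]; apply/integrableP; split.
- exact/measurable_EFinP.
- by rewrite /= -E.
- exact/measurable_EFinP.
- by rewrite /= E.
Qed.

Lemma Rintegral_std_normal (f : R -> R) : gamma.-integrable setT (EFin \o f) ->
  \int[gamma]_x f x = \int[mu]_x (f x * pdf x).
Proof.
move=> fi; have mf : measurable_fun setT f.
  by apply/measurable_EFinP; exact: measurable_int fi.
have dom : gamma `<< mu by exact: normal_prob_dominates.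
rewrite /Rintegral -(Radon_Nikodym_change_of_variables dom)//=.
under [in RHS]eq_integral do rewrite EFinM.
congr fine; apply: ae_eq_integral => //.
- apply: emeasurable_funM; first exact: measurable_int fi.
  by apply: (measurable_int mu); apply: Radon_Nikodym_integrable.
- apply: emeasurable_funM; first exact: measurable_int fi.
  by apply/measurable_EFinP; exact: measurable_normal_pdf.
- apply: ae_eqe_mul2l; apply: integral_ae_eq => //.
  + exact: Radon_Nikodym_integrable.
  + by apply/measurable_EFinP; exact: measurable_normal_pdf.
  + by move=> E _ mE; rewrite -Radon_Nikodym_integral.
Qed.

(** Times [pdf], the function becomes a multiple of the density of variance 2. It is the dominating
    function in [integrable_std_normal_le]. *)
Lemma integrable_std_normal_expR :
  gamma.-integrable setT (EFin \o (fun x => expR (x ^+ 2 / 4))).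
Proof.
apply/integrable_std_normalP.
  by apply: measurableT_comp => //; apply: measurable_funM => //; exact: measurable_funX.
have i2 := @integrable_normal_pdf R 0 (Num.sqrt 2).
have s2 : Num.sqrt (2 : R) != 0 by rewrite gt_eqF// sqrtr_gt0.
have -> : (fun x => expR (x ^+ 2 / 4) * pdf x) =
    (fun x => normal_peak 1 / normal_peak (Num.sqrt 2) * normal_pdf 0 (Num.sqrt 2) x).
  apply/funext => x; rewrite std_normal_pdfE normal_pdfE// /normal_fun subr0.
  rewrite sqr_sqrtr//.
  have p0 : normal_peak (Num.sqrt 2 : R) != 0 by rewrite gt_eqF// normal_peak_gt0.
  rewrite mulrA divfK// mulrCA -expRD; congr (_ * expR _).
  by rewrite -[2 *+ 2]mulr_natr; field.
exact: (integrableZl measurableT (normal_peak 1 / normal_peak (Num.sqrt 2)) i2).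
Qed.

Lemma integrable_std_normal_le (f : R -> R) (c : R) :
  measurable_fun setT f -> (forall x, `|f x| <= c * expR (x ^+ 2 / 4)) ->
  gamma.-integrable setT (EFin \o f).
Proof.
move=> mf fc; apply: (@integrableR_le _ _ _ gamma _ (fun x => c * expR (x ^+ 2 / 4))) => //.
exact: integrableR_Z integrable_std_normal_expR.
Qed.

Lemma expR4_ge1 (x : R) : 1 <= expR (x ^+ 2 / 4).
Proof. by rewrite -expR0 ler_expR divr_ge0// sqr_ge0. Qed.

Lemma sqr_le_expR4 (x : R) : x ^+ 2 <= 4 * expR (x ^+ 2 / 4).
Proof. have := expR_ge1Dx (x ^+ 2 / 4); lra. Qed.

Lemma norm_le_expR4 (x : R) : `|x| <= 5 * expR (x ^+ 2 / 4).
Proof.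
have := expR_ge1Dx (x ^+ 2 / 4); have := sqr_ge0 (`|x| - 1).
have -> : (`|x| - 1) ^+ 2 = x ^+ 2 - 2 * `|x| + 1.
  by rewrite -[x ^+ 2]real_normK ?num_real//; ring.
have := sqr_ge0 x; lra.
Qed.

Let cvg_seq (F : R -> R) (c : R) :
  (forall x, 1 <= `|x| -> `|F x| <= c / `|x|) ->
  F n%:R @[n --> \oo] --> (0 : R) /\ F (- n%:R) @[n --> \oo] --> (0 : R).
Proof.
move=> Fc.
have c0 : 0 <= c.
  by have := le_trans (normr_ge0 _) (Fc 1 _); rewrite normr1 divr1; apply.
have lim0 : c * n%:R^-1 @[n --> \oo] --> (0 : R).
  rewrite -(mulr0 c); apply: cvgMr.
  by apply/gtr0_cvgV0; [near=> n; rewrite ltr0n; near: n; exact: nbhs_infty_gt|exact: cvgr_idn].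
have limN : - (c * n%:R^-1) @[n --> \oo] --> (0 : R).
  by rewrite -[X in _ --> X]oppr0; apply: cvgN.
split; apply: (squeeze_cvgr _ limN lim0); near=> n;
  (have n1 : 1 <= (n%:R : R) by rewrite ler1n; near: n; exact: nbhs_infty_gt);
  rewrite -ler_norml.
- by apply: (le_trans (Fc _ _)); rewrite ger0_norm.
- by apply: (le_trans (Fc _ _)); rewrite normrN ger0_norm.
Unshelve. all: by end_near. Qed.

(* Integration by parts against the Gaussian weight reduces to this: both
   boundary terms vanish. *)
Let integral_derivative (F f : R -> R) (c : R) :
  (forall x, is_derive x (1 : R) F (f x)) -> continuous f ->
  mu.-integrable setT (EFin \o f) ->
  (forall x, 1 <= `|x| -> `|F x| <= c / `|x|) ->
  \int[mu]_x f x = 0.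
Proof.
move=> dF cf fi Fc.
have [Fp Fm] := cvg_seq Fc.
have mf : measurable_fun setT (EFin \o f) by exact: measurable_int fi.
pose fn n := (EFin \o f) \_ (`[- n%:R, n%:R]%classic : set R).
have Efn n : (0 < n)%N -> (\int[mu]_x fn n x = (F n%:R - F (- n%:R))%:E)%E.
  move=> n0; rewrite -integral_mkcond/= EFinB.
  apply: continuous_FTC2.
  - by rewrite gtrN// ltr0n.
  - exact: continuous_subspaceT.
  - have dF' x : derivable F x 1 by exact: ex_derive.
    have cF x : {for x, continuous F}.
      exact/differentiable_continuous/derivable1_diffP.
    split => //.
    + by apply: cvg_at_right_filter; exact: cF.
    + by apply: cvg_at_left_filter; exact: cF.
  - by move=> x _; rewrite derive1E derive_val.
have : (fun n => \int[mu]_x fn n x)%E @ \oo --> 0%E.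
  have : (F n%:R - F (- n%:R))%:E @[n --> \oo] --> 0%E.
    apply: cvg_EFin; first by apply: nearW.
    by rewrite -(subrr (0 : R)); apply: cvgB.
  apply: cvg_trans; apply: near_eq_cvg; near=> n.
  by rewrite Efn//; near: n; exact: nbhs_infty_gt.
move=> l0; rewrite /Rintegral.
suff -> : (\int[mu]_x (f x)%:E = 0)%E by [].
have mfn n : measurable_fun setT (fn n).
  apply/measurable_restrict => //.
  by rewrite setTI; exact: measurable_funTS.
have fnf : {ae mu, forall x, setT x -> fn ^~ x @ \oo --> (EFin \o f) x}.
  apply: aeW => x _; apply: cvg_near_cst; near=> n.
  rewrite /fn patchE ifT// inE/= in_itv/= -ler_norml.
  by near: n; exact: nbhs_infty_ger.
have fnle : {ae mu, forall x n, setT x -> (`|fn n x| <= `|(f x)%:E|)%E}.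
  apply: aeW => x n _; rewrite /fn patchE; case: ifP => // _.
  by rewrite abse0.
have [_ _ l1] := @dominated_convergence _ _ _ mu setT measurableT fn
  (EFin \o f) (fun x => `|(f x)%:E|%E) mfn mf fnf (integrable_abse fi) fnle.
exact: (cvg_unique _ l1 l0).
Unshelve. all: by end_near. Qed.

(** The decay required by [integral_derivative]; the factor 1 + |x| covers both primitives used
    below, [pdf x * sin (a * x + t)] and [x * pdf x]. *)
Let expR_bound (x : R) : 1 <= `|x| ->
  (1 + `|x|) * expR (- (x ^+ 2 / 2)) <= 4 / `|x|.
Proof.
move=> x1; have x0 : 0 < `|x| by lra.
rewrite expRN ler_pdivrMr ?expR_gt0// mulrAC ler_pdivlMr//.
have := expR_ge1Dx (x ^+ 2 / 2).
have -> : x ^+ 2 = `|x| ^+ 2 by rewrite real_normK ?num_real.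
move: `|x| x0 x1 => y; nra.
Qed.

Let is_derive_pdf x : is_derive x (1 : R) pdf (- x * pdf x).
Proof.
have -> : pdf = fun x => normal_peak 1 * expR (- (x ^+ 2 / 2)).
  by apply/funext => y; exact: std_normal_pdfE.
apply: is_derive_eq.
by rewrite !scaler1 /GRing.scale/=; field.
Qed.

Let pdf_continuous : continuous pdf.
Proof. exact/continuous_normal_pdf/oner_neq0. Qed.

(** Gaussian integration by parts (Stein's identity) for the sine. *)
Lemma std_normal_sin_ibp (a t : R) :
  \int[gamma]_x (x * sin (a * x + t)) = a * \int[gamma]_x cos (a * x + t).
Proof.
have ms : measurable_fun setT (fun x : R => sin (a * x + t)).
  apply: continuous_measurable_fun => x; apply: continuous_comp; last exact: continuous_sin.
  by apply: cvgD; [apply: cvgMr; exact: cvg_id|exact: cvg_cst].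
have mc : measurable_fun setT (fun x : R => cos (a * x + t)).
  apply: continuous_measurable_fun => x; apply: continuous_comp; last exact: continuous_cos.
  by apply: cvgD; [apply: cvgMr; exact: cvg_id|exact: cvg_cst].
have i1 : gamma.-integrable setT (EFin \o (fun x => x * sin (a * x + t))).
  apply: (@integrable_std_normal_le _ 5); first exact: measurable_funM.
  move=> x; rewrite normrM; apply: le_trans (norm_le_expR4 x).
  by rewrite ler_piMr// ler_norml sin_geN1 sin_le1.
have i2 : gamma.-integrable setT (EFin \o (fun x => cos (a * x + t))).
  apply: (@integrable_std_normal_le _ 1) => // x; rewrite mul1r.
  apply: (@le_trans _ _ 1); first by rewrite ler_norml cos_geN1 cos_le1.
  exact: expR4_ge1.
apply/eqP; rewrite -subr_eq0 -RintegralZl// -RintegralB//; last exact: integrableR_Z.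
rewrite Rintegral_std_normal; last by apply: integrableR_B => //; exact: integrableR_Z.
(* The sign is flipped to match the derivative of [pdf x * sin (a * x + t)], which is [- (x * sin (a
   * x + t) - a * cos (a * x + t)) * pdf x]. *)
rewrite -oppr_eq0 -mulN1r -RintegralZl//; last first.
  apply/integrable_std_normalP.
    by apply: measurable_funB; [exact: measurable_funM|exact: measurable_funM].
  by apply: integrableR_B => //; exact: integrableR_Z.
apply/eqP.
apply: (@integral_derivative (fun x => pdf x * sin (a * x + t)) _ (4 * normal_peak 1)).
- move=> x; have dp := is_derive_pdf x; apply: is_derive_eq.
  rewrite /GRing.scale/= ?mulr1 ?addr0 ?add0r; ring.
- move=> x; apply: cvgMr; apply: cvgM; last exact: pdf_continuous.
  apply: cvgB.
    apply: cvgM; first exact: cvg_id.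
    apply: continuous_comp; last exact: continuous_sin.
    by apply: cvgD; [apply: cvgMr; exact: cvg_id|exact: cvg_cst].
  apply: cvgMr; apply: continuous_comp; last exact: continuous_cos.
  by apply: cvgD; [apply: cvgMr; exact: cvg_id|exact: cvg_cst].
- apply: (@integrableR_Z _ _ _ mu); apply/integrable_std_normalP.
    by apply: measurable_funB; [exact: measurable_funM|exact: measurable_funM].
  by apply: integrableR_B => //; exact: integrableR_Z.
- move=> x x1; rewrite normrM [`|pdf x|]ger0_norm ?normal_pdf_ge0// std_normal_pdfE.
  apply: (@le_trans _ _ (normal_peak 1 * ((1 + `|x|) * expR (- (x ^+ 2 / 2))))).
    rewrite -mulrA ler_wpM2l ?normal_peak_ge0// mulrC ler_wpM2r ?expR_ge0//.
    apply: (@le_trans _ _ 1); last by rewrite lerDl.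
    by rewrite ler_norml sin_geN1 sin_le1.
  rewrite [leRHS]mulrAC [leRHS]mulrC ler_wpM2l ?normal_peak_ge0//; exact: expR_bound.
Qed.

(** The derivative of [x * pdf x] is [(1 - x ^+ 2) * pdf x]. *)
Lemma std_normal_sqr : \int[gamma]_x (x ^+ 2) = 1.
Proof.
have i1 : gamma.-integrable setT (EFin \o (fun x => x ^+ 2)).
  apply: (@integrable_std_normal_le _ 4); first exact: measurable_funX.
  by move=> x; rewrite ger0_norm ?sqr_ge0//; exact: sqr_le_expR4.
have i2 : gamma.-integrable setT (EFin \o (fun x : R => 1)).
  apply: (@integrable_std_normal_le _ 1) => // x.
  by rewrite mul1r normr1 expR4_ge1.
have e1 : \int[gamma]_x 1 = 1 :> R.
  by rewrite Rintegral_cst//= mul1r probability_setT.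
rewrite -[RHS]e1; apply/eqP; rewrite -subr_eq0 -RintegralB//.
rewrite Rintegral_std_normal; last exact: integrableR_B.
rewrite -oppr_eq0 -mulN1r -RintegralZl//; last first.
  apply/integrable_std_normalP; last exact: integrableR_B.
  by apply: measurable_funB => //; exact: measurable_funX.
apply/eqP.
apply: (@integral_derivative (fun x => x * pdf x) _ (4 * normal_peak 1)).
- move=> x; have dp := is_derive_pdf x; apply: is_derive_eq.
  rewrite /GRing.scale/= ?mulr1; ring.
- move=> x; apply: cvgMr; apply: cvgM; last exact: pdf_continuous.
  by apply: cvgB; [exact: exprn_continuous|exact: cvg_cst].
- apply: (@integrableR_Z _ _ _ mu); apply/integrable_std_normalP; last exact: integrableR_B.
  by apply: measurable_funB => //; exact: measurable_funX.
- move=> x x1; rewrite normrM std_normal_pdfE normrM [X in _ * (X * _)]ger0_norm ?normal_peak_ge0//.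
  rewrite [X in _ * (_ * X)]ger0_norm ?expR_ge0//.
  apply: (@le_trans _ _ (normal_peak 1 * ((1 + `|x|) * expR (- (x ^+ 2 / 2))))).
    rewrite mulrCA ler_wpM2l ?normal_peak_ge0// ler_wpM2r ?expR_ge0//.
    by rewrite lerDr.
  rewrite [leRHS]mulrAC [leRHS]mulrC ler_wpM2l ?normal_peak_ge0//; exact: expR_bound.
Qed.

(** As a function of the frequency, the integral [C] solves C' = - b C: differentiate under the
    integral, dominated by |y|, and integrate by parts. So exp (b^2 / 2) C b is constant, with value
    cos t at b = 0. *)
Lemma std_normal_cos (a t : R) :
  \int[gamma]_x cos (a * x + t) = expR (- (a ^+ 2 / 2)) * cos t.
Proof.
pose C b : R := \int[gamma]_x cos (b * x + t).
have mc b : measurable_fun setT (fun x : R => cos (b * x + t)).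
  apply: continuous_measurable_fun => x; apply: continuous_comp; last exact: continuous_cos.
  by apply: cvgD; [apply: cvgMr; exact: cvg_id|exact: cvg_cst].
have dcos b x : is_derive b (1 : R) (fun b : R => cos (b * x + t)) (- x * sin (b * x + t)).
  by apply: is_derive_eq; rewrite /GRing.scale/= !mulr1 ?addr0 ?add0r; ring.
have ic b : gamma.-integrable setT (EFin \o (fun x : R => cos (b * x + t))).
  apply: (@integrable_std_normal_le _ 1) => // x; rewrite mul1r.
  apply: (@le_trans _ _ 1); first by rewrite ler_norml cos_geN1 cos_le1.
  exact: expR4_ge1.
have dC b : is_derive b (1 : R) C (- b * C b).
  have bI : (`]b - 1, b + 1[%classic : set R) b by rewrite /= in_itv/=; lra.
  have icI x : (`]b - 1, b + 1[%classic : set R) x ->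
      gamma.-integrable setT (EFin \o (fun y : R => cos (x * y + t))) by move=> _; exact: ic.
  have dI x y : (`]b - 1, b + 1[%classic : set R) x -> setT y ->
      derivable (fun b : R => cos (b * y + t)) x 1.
    by move=> _ _; exact: ex_derive.
  have iabs : gamma.-integrable setT (EFin \o (fun x : R => `|x|)).
    apply: (@integrable_std_normal_le _ 5); first exact: normr_measurable.
    by move=> x; rewrite normr_id; exact: norm_le_expR4.
  have ub x y : (`]b - 1, b + 1[%classic : set R) x -> setT y ->
      `|partial1of2 (fun b y : R => cos (b * y + t)) x y| <= `|y|.
    move=> _ _; rewrite partial1of2E derive_val normrM normrN ler_piMr//.
    by rewrite ler_norml sin_geN1 sin_le1.
  have d := derivable_under_integral measurableT bI icI dI (fun y => normr_ge0 y) iabs ub.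
  have v := differentiation_under_integral measurableT bI icI dI (fun y => normr_ge0 y) iabs ub.
  apply: DeriveDef; first exact: d.
  rewrite -derive1E v.
  transitivity (\int[gamma]_x (-1 * (x * sin (b * x + t)))).
    by apply: eq_Rintegral => y _; rewrite partial1of2E derive_val mulN1r mulNr.
  rewrite RintegralZl//; last first.
    apply: (@integrable_std_normal_le _ 5).
      apply: measurable_funM => //.
      apply: continuous_measurable_fun => x; apply: continuous_comp; last exact: continuous_sin.
      by apply: cvgD; [apply: cvgMr; exact: cvg_id|exact: cvg_cst].
    move=> x; rewrite normrM; apply: le_trans (norm_le_expR4 x).
    by rewrite ler_piMr// ler_norml sin_geN1 sin_le1.
  by rewrite std_normal_sin_ibp mulN1r mulNr.
pose D b := expR (b ^+ 2 / 2) * C b.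
have dD b : is_derive b (1 : R) D 0.
  by apply: is_derive_eq; rewrite /GRing.scale/= ?mulr1; field.
have := is_derive_0_is_cst a 0 dD.
rewrite /D expr0n/= mul0r expR0 mul1r.
have -> : C 0 = cos t.
  rewrite /C; under eq_Rintegral do rewrite mul0r add0r.
  by rewrite Rintegral_cst//= probability_setT mulr1.
by move=> <-; rewrite mulrA -expRD addNr expR0 mul1r.
Qed.

Lemma std_normal_xsin (a t : R) :
  \int[gamma]_x (x * sin (a * x + t)) = a * expR (- (a ^+ 2 / 2)) * cos t.
Proof. by rewrite std_normal_sin_ibp std_normal_cos mulrA. Qed.

End gaussian.

(** * The sawtooth function *)

Section sawtooth.
Context (R : realType).
Implicit Types (q t u : R).

(** The rounding error at unit step: [quantizer delta t - t] equals
    [delta * sawtooth (t / delta)]. *)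
Definition sawtooth u : R := (Num.ceil (u - 2^-1))%:~R - u.

Lemma sawtooth_itv u : - 2^-1 <= sawtooth u < 2^-1.
Proof.
rewrite /sawtooth; have := ceil_itv (u - 2^-1).
by rewrite intrD mulrN1z => /andP[? ?]; apply/andP; split; lra.
Qed.

(** The Chebyshev recurrence; with [cos_succ] it turns trigonometric geometric sums into inductions
    without complex numbers. *)
Let sin_succ n t : sin (n.+2%:R * t) = 2 * cos t * sin (n.+1%:R * t) - sin (n%:R * t).
Proof.
have -> : n.+2%:R * t = n.+1%:R * t + t by rewrite -natr1 mulrDl mul1r.
have -> : n%:R * t = n.+1%:R * t - t by rewrite -natr1 mulrDl mul1r addrK.
by rewrite sinD sinB; ring.
Qed.

Let cos_succ n t : cos (n.+2%:R * t) = 2 * cos t * cos (n.+1%:R * t) - cos (n%:R * t).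
Proof.
have -> : n.+2%:R * t = n.+1%:R * t + t by rewrite -natr1 mulrDl mul1r.
have -> : n%:R * t = n.+1%:R * t - t by rewrite -natr1 mulrDl mul1r addrK.
by rewrite cosD cosB; ring.
Qed.

(** The imaginary part of a finite geometric sum in q e^(it), cleared of its denominator 1 - 2 q cos
    t + q^2 = |1 - q e^(it)|^2. [sum_cos] is a real part at q = -1. *)
Let sum_sin q t M :
  (1 - 2 * q * cos t + q ^+ 2) * \sum_(i < M) q ^+ i * sin (i.+1%:R * t) =
  sin t - q ^+ M * sin (M.+1%:R * t) + q ^+ M.+1 * sin (M%:R * t).
Proof.
elim: M => [|M IH]; first by rewrite big_ord0 mul1r mul0r sin0 !mulr0 mul1r; ring.
rewrite big_ord_recr/= mulrDr IH sin_succ !exprS; ring.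
Qed.

Let sum_cos t n :
  (2 + 2 * cos t) * \sum_(i < n) (-1) ^+ i.+1 * cos (i.+1%:R * t) =
  (-1) ^+ n * (cos (n.+1%:R * t) + cos (n%:R * t)) - cos t - 1.
Proof.
elim: n => [|n IH].
  by rewrite big_ord0 expr0 mul0r cos0 mulr0 !mul1r; ring.
rewrite big_ord_recr/= mulrDr IH cos_succ !exprS; ring.
Qed.

Let denom_gt0 q t : `|q| < 1 -> 0 < 1 - q * cos t.
Proof.
move=> q1; rewrite subr_gt0; apply: le_lt_trans (ler_norm _) _.
rewrite normrM; apply: le_lt_trans q1.
by rewrite ler_piMr// ler_norml cos_geN1 cos_le1.
Qed.

Let quad_ge q t : `|q| < 1 -> (1 - `|q|) ^+ 2 <= 1 - 2 * q * cos t + q ^+ 2.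
Proof.
move=> q1; have : q * cos t <= `|q|.
  apply: le_trans (ler_norm _) _.
  by rewrite normrM ler_piMr// ler_norml cos_geN1 cos_le1.
have : q ^+ 2 = `|q| ^+ 2 by rewrite real_normK ?num_real.
by move=> ->; nra.
Qed.

(** The arctangent is the imaginary part of - log (1 - q e^(it)), the sum of the series with terms
    q^n sin (n t) / n. *)
Let is_derive_abel q t : `|q| < 1 ->
  is_derive q (1 : R) (fun q => atan (q * sin t / (1 - q * cos t)))
    (sin t / (1 - 2 * q * cos t + q ^+ 2)).
Proof.
move=> q1; have d0 := denom_gt0 t q1.
have d0' : 1 - q * cos t != 0 by rewrite gt_eqF.
have D0 : 1 - 2 * q * cos t + q ^+ 2 != 0.
  by rewrite gt_eqF// (lt_le_trans _ (quad_ge t q1))// exprn_gt0// subr_gt0.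
have dd : is_derive q (1 : R) (fun q => 1 - q * cos t) (- cos t).
  by apply: is_derive_eq; rewrite /GRing.scale/= ?mulr1 ?mulr0 ?add0r ?addr0; ring.
have di := @is_deriveV R (fun q => 1 - q * cos t) q (- cos t) 1 d0' dd.
have dn : is_derive q (1 : R) (fun q => q * sin t) (sin t).
  by apply: is_derive_eq; rewrite /GRing.scale/= ?mulr1 ?mulr0 ?add0r ?addr0; ring.
have dm := is_deriveM dn di.
have dc := is_derive1_comp (is_derive1_atan _) dm.
suff -> : sin t / (1 - 2 * q * cos t + q ^+ 2) =
    (1 + (q * sin t * (1 - q * cos t)^-1) ^+ 2)^-1 *
    (q * sin t * (- (1 - q * cos t) ^- 2 * - cos t) + (1 - q * cos t)^-1 * sin t).
  exact: dc.
have -> : 1 + (q * sin t * (1 - q * cos t)^-1) ^+ 2 =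
    (1 - 2 * q * cos t + q ^+ 2) / (1 - q * cos t) ^+ 2.
  have c2 : sin t ^+ 2 = 1 - cos t ^+ 2 by rewrite -(cos2Dsin2 t); ring.
  by rewrite !exprMn c2 exprVn; field.
by field; apply/andP.
Qed.

Let is_derive_partial q t M :
  is_derive q (1 : R) (fun q => \sum_(i < M) q ^+ i.+1 * sin (i.+1%:R * t) / i.+1%:R)
    (\sum_(i < M) q ^+ i * sin (i.+1%:R * t)).
Proof.
elim: M => [|M IH].
  rewrite big_ord0; have -> : (fun q : R => \sum_(i < 0) q ^+ i.+1 * sin (i.+1%:R * t) / i.+1%:R) = cst 0.
    by apply/funext => x; rewrite big_ord0.
  exact: is_derive_cst.
rewrite big_ord_recr/=.
have -> : (fun q : R => \sum_(i < M.+1) q ^+ i.+1 * sin (i.+1%:R * t) / i.+1%:R) =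
   (fun q : R => \sum_(i < M) q ^+ i.+1 * sin (i.+1%:R * t) / i.+1%:R) +
   (fun q : R => q ^+ M.+1 * sin (M.+1%:R * t) / M.+1%:R).
  by apply/funext => x; rewrite big_ord_recr.
have dX : is_derive q (1 : R) (fun q : R => q ^+ M.+1) (M.+1%:R * q ^+ M).
  apply: DeriveDef; first exact: exprn_derivable.
  by rewrite exp_derive/= /GRing.scale/= mulr1.
apply: is_deriveD; apply: is_derive_eq.
rewrite /GRing.scale/= ?mulr1 ?mulr0 ?add0r ?addr0.
by field; rewrite nat1r pnatr_eq0.
Qed.

(* The difference of the two sides, as a function of q, vanishes at 0 and its
   derivative is the tail of a geometric series. *)
Let abel_dist r t M : 0 <= r < 1 ->
  `|atan (- r * sin t / (1 + r * cos t)) -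
    \sum_(i < M) (- r) ^+ i.+1 * sin (i.+1%:R * t) / i.+1%:R|
  <= 2 * r ^+ M / (1 - r) ^+ 2.
Proof.
move=> /andP[r0 r1].
pose h q := atan (q * sin t / (1 - q * cos t)) -
  \sum_(i < M) q ^+ i.+1 * sin (i.+1%:R * t) / i.+1%:R.
pose dh q := sin t / (1 - 2 * q * cos t + q ^+ 2) -
  \sum_(i < M) q ^+ i * sin (i.+1%:R * t).
have dhP q : `|q| < 1 -> is_derive q (1 : R) h (dh q).
  move=> q1; have d1 := is_derive_abel t q1; have d2 := is_derive_partial q t M.
  exact: is_deriveB.
have inI x : x \in `[- r, 0] -> `|x| <= r.
  by rewrite in_itv/= => /andP[? ?]; rewrite ler0_norm// lerNl.
have leab : - r <= 0 by rewrite oppr_le0.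
have dhI x : x \in `]- r, 0[ -> is_derive x (1 : R) h (dh x).
  move=> xI; apply: dhP; apply: le_lt_trans r1; apply: inI.
  exact: subset_itv_oo_cc xI.
have ch : {within `[- r, 0], continuous h}.
  apply: derivable_within_continuous => x /inI xr.
  by have [] := dhP x (le_lt_trans xr r1).
have [c cI hE] := MVT_segment leab dhI ch.
have cr := inI _ cI; have c1 := le_lt_trans cr r1.
have h0 : h 0 = 0.
  rewrite /h mul0r mul0r atan0 sub0r big1 ?oppr0// => i _.
  by rewrite expr0n/= mul0r mul0r.
have hr : h (- r) = - (dh c * r).
  by apply/eqP; rewrite -eqr_oppLR -[- h _]sub0r -h0 hE sub0r opprK.
have -> : 1 + r * cos t = 1 - - r * cos t by rewrite mulNr opprK.
rewrite -/(h (- r)) hr normrN normrM (ger0_norm r0).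
have Q0 : 0 < (1 - r) ^+ 2 by rewrite exprn_gt0// subr_gt0.
have Q := quad_ge t c1.
have Qr : (1 - r) ^+ 2 <= 1 - 2 * c * cos t + c ^+ 2.
  by apply: le_trans Q; rewrite ler_pXn2r// ?nnegrE; lra.
have D0 : 0 < 1 - 2 * c * cos t + c ^+ 2 by exact: lt_le_trans Qr.
have -> : dh c = (c ^+ M * sin (M.+1%:R * t) - c ^+ M.+1 * sin (M%:R * t)) /
    (1 - 2 * c * cos t + c ^+ 2).
  apply/(mulfI (lt0r_neq0 D0)); rewrite /dh mulrBr sum_sin.
  rewrite [in LHS]mulrCA divff ?lt0r_neq0// mulr1 [RHS]mulrCA divff ?lt0r_neq0//; ring.
rewrite normrM normfV (gtr0_norm D0) -mulrA [_^-1 * r]mulrC mulrA.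
apply: (@le_trans _ _ (2 * r ^+ M / (1 - 2 * c * cos t + c ^+ 2))).
  rewrite ler_wpM2r ?invr_ge0 ?(ltW D0)//.
  apply: (@le_trans _ _ (2 * `|c| ^+ M * r)).
    rewrite ler_wpM2r//; apply: le_trans (ler_normB _ _) _.
    have -> : 2 * `|c| ^+ M = `|c| ^+ M + `|c| ^+ M by ring.
    rewrite !normrM !normrX lerD//.
      by rewrite ler_piMr ?exprn_ge0// ler_norml sin_geN1 sin_le1.
    rewrite exprS; apply: (@le_trans _ _ (`|c| * `|c| ^+ M)).
      by rewrite ler_piMr ?mulr_ge0 ?exprn_ge0// ler_norml sin_geN1 sin_le1.
    by rewrite ler_piMl ?exprn_ge0// ltW.
  rewrite -mulrA ler_wpM2l//; apply: (@le_trans _ _ (`|c| ^+ M)).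
    by rewrite ler_piMr ?exprn_ge0// ltW.
  by rewrite lerXn2r ?nnegrE.
by rewrite ler_wpM2l ?mulr_ge0 ?exprn_ge0// lef_pV2 ?posrE.
Qed.

Let geometric_small r (e : R) : 0 <= r < 1 -> 0 < e -> exists M, r ^+ M < e.
Proof.
move=> /andP[r0 r1] e0.
have : r ^+ n @[n --> \oo] --> 0 by apply: cvg_expr; rewrite ger0_norm.
move=> /cvgrPdist_lt /(_ _ e0) [M _ /(_ M (leqnn M))].
by rewrite sub0r normrN ger0_norm ?exprn_ge0// => ?; exists M.
Qed.

Let trig_shift (n : int) u :
  sin (2 * pi * (u + n%:~R)) = sin (2 * pi * u) /\
  cos (2 * pi * (u + n%:~R)) = cos (2 * pi * u).
Proof.
have E (m : nat) v : 2 * pi * (v + m%:R) = 2 * pi * v + (pi *+ 2) *+ m :> R.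
  by rewrite -mulrnA -[pi *+ _]mulr_natr natrM; ring.
case: n => m.
  have -> : (Posz m)%:~R = m%:R :> R by [].
  by rewrite E (periodicn (@sinD2pi R)) (periodicn (@cosD2pi R)).
have -> : (Negz m)%:~R = - m.+1%:R :> R by [].
rewrite -[in X in _ = X /\ _](subrK m.+1%:R u) -[in X in _ /\ _ = X](subrK m.+1%:R u).
by rewrite E (periodicn (@sinD2pi R)) (periodicn (@cosD2pi R)).
Qed.

(** The Abel sum at r = 1. With y the distance from u to its rounded value, counted with sign, the
    quotient is - tan (pi y) by the double-angle formulas, and |y| < 1/2 lets the arctangent undo
    the tangent. *)
Let atan_limit u : 1 + cos (2 * pi * u) != 0 ->
  atan (- sin (2 * pi * u) / (1 + cos (2 * pi * u))) = pi * sawtooth u.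
Proof.
pose n := Num.ceil (u - 2^-1); pose y := u - n%:~R.
have yE : u = y + n%:~R by rewrite /y subrK.
have [-> ->] : sin (2 * pi * u) = sin (2 * pi * y) /\ cos (2 * pi * u) = cos (2 * pi * y).
  by rewrite yE; exact: trig_shift.
have -> : sawtooth u = - y by rewrite /sawtooth -/n /y; ring.
have := sawtooth_itv u; rewrite /sawtooth -/n => /andP[y1 y2] c0.
(* The rounding interval is closed at 1/2; this endpoint is the jump, which [c0] excludes. *)
have yh : y != 2^-1.
  apply: contra_neq c0 => ->.
  by rewrite mulrAC divff ?mul1r ?cospi ?subrr// pnatr_eq0.
have pi0 := @pi_gt0 R.
have yI : - (pi * y) \in `]- (pi / 2), pi / 2[.
  rewrite in_itv/=; have : y < 2^-1 by rewrite lt_neqAle yh /y; lra.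
  have : - 2^-1 < y by rewrite /y; lra.
  by move=> ? ?; apply/andP; split; nra.
have cy : cos (pi * y) != 0.
  by rewrite gt_eqF// -cosN cos_gt0_pihalf//; move: yI; rewrite in_itv.
rewrite mulrN -[RHS](tanK yI); congr atan.
rewrite tanN /tan.
have -> : 2 * pi * y = pi * y + pi * y by ring.
rewrite sinD cosD.
have -> : 1 + (cos (pi * y) * cos (pi * y) - sin (pi * y) * sin (pi * y)) =
    2 * cos (pi * y) ^+ 2.
  by have := cos2Dsin2 (pi * y); lra.
by field.
Qed.

(* Abel means of the Fourier series: unlike the partial sums of the series,
   they are bounded by the arctangent formula. *)
Lemma sawtooth_approx : exists (M : nat -> nat) (c : nat -> nat -> R),
  [/\ forall k i, `|c k i| <= 1,
      forall k u, `|\sum_(i < M k) c k i / (pi * i.+1%:R) *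
                      sin (i.+1%:R * (2 * pi * u))| <= 1 &
      forall u, 1 + cos (2 * pi * u) != 0 ->
      \sum_(i < M k) c k i / (pi * i.+1%:R) * sin (i.+1%:R * (2 * pi * u))
        @[k --> \oo] --> sawtooth u].
Proof.
pose r k : R := 1 - k.+2%:R^-1.
have k0 k : 0 < (k.+2%:R : R)^-1 by rewrite invr_gt0 ltr0n.
have r01 k : 0 <= r k < 1.
  by rewrite /r subr_ge0 invf_le1 ?ler1n ?ltr0n//= ltrBlDr ltrDl k0.
have pi0 := @pi_gt0 R; have pi2 := @pi_ge2 R.
(* The truncation order is chosen after the radius, so that the error of [abel_dist] tends to 0
   uniformly in u although 1 - r k tends to 0. *)
have /choice[M MP] : forall k, exists M, 2 * r k ^+ M / (1 - r k) ^+ 2 <= k.+2%:R^-1.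
  move=> k; have e0 : 0 < k.+2%:R^-1 * k.+2%:R^-1 ^+ 2 / 2 :> R.
    by rewrite divr_gt0// mulr_gt0// exprn_gt0.
  have [M rM] := geometric_small (r01 k) e0; exists M.
  have -> : 1 - r k = k.+2%:R^-1 by rewrite /r opprB addrC subrK.
  rewrite ltr_pdivlMr// in rM.
  by rewrite ler_pdivrMr ?exprn_gt0// mulrC ltW.
exists M, (fun k i => (- r k) ^+ i.+1).
have sE k u : \sum_(i < M k) (- r k) ^+ i.+1 / (pi * i.+1%:R) * sin (i.+1%:R * (2 * pi * u)) =
    pi^-1 * \sum_(i < M k) (- r k) ^+ i.+1 * sin (i.+1%:R * (2 * pi * u)) / i.+1%:R.
  rewrite mulr_sumr; apply: eq_bigr => i _.
  by rewrite invfM; ring.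
have dist k u := le_trans (abel_dist (2 * pi * u) (M k) (r01 k)) (MP k).
split=> [k i|k u|u c0].
- have /andP[rk0 rk1] := r01 k.
  by rewrite normrX normrN ger0_norm// exprn_ile1// ltW.
(* Up to the factor 1 / pi, the sum is within 1 of an arctangent, hence at most pi / 2 + 1 <= pi. *)
- rewrite sE normrM normfV [`|pi|]gtr0_norm// ler_pdivrMl// mulr1.
  have := dist k u; rewrite distrC => /(le_trans (lerB_dist _ _)).
  have : `|atan (- r k * sin (2 * pi * u) / (1 + r k * cos (2 * pi * u)))| <= pi / 2.
    by rewrite ler_norml ltW ?atan_gtNpi2//= ltW// atan_ltpi2.
  have : k.+2%:R^-1 <= 1 :> R by rewrite invf_le1 ?ler1n ?ltr0n.
  move: pi2; move: `|atan _| => a; move: `|\sum_(_ < _) _| => b.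
  by move: (k.+2%:R^-1 : R) (@pi R) => z p *; lra.
- under eq_fun do rewrite sE.
  have -> : sawtooth u = pi^-1 * (pi * sawtooth u) by rewrite mulKf// gt_eqF.
  apply: cvgMr; rewrite -atan_limit//.
  have lim0 : (k.+2%:R^-1 : R) @[k --> \oo] --> (0 : R).
    have := @cvg_harmonic R; rewrite -(cvg_shiftS (fun n => n.+1%:R^-1 : R)).
    exact.
  have limr : r k @[k --> \oo] --> (1 : R).
    by rewrite -[X in _ --> X]subr0; apply: cvgB => //; exact: cvg_cst.
  have lima : atan (- r k * sin (2 * pi * u) / (1 + r k * cos (2 * pi * u))) @[k --> \oo]
      --> atan (- sin (2 * pi * u) / (1 + cos (2 * pi * u))).
    apply: (cvg_comp _ atan); last exact: continuous_atan.
    have -> : - sin (2 * pi * u) / (1 + cos (2 * pi * u)) =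
        -1 * sin (2 * pi * u) / (1 + 1 * cos (2 * pi * u)) by rewrite mulN1r mul1r.
    apply: cvgM; first by apply: cvgMl; exact: cvgN.
    apply: cvgV; first by rewrite mul1r.
    by apply: cvgD; [exact: cvg_cst|apply: cvgMl].
  rewrite -[X in _ --> X]addr0.
  have E k : \sum_(i < M k) (- r k) ^+ i.+1 * sin (i.+1%:R * (2 * pi * u)) / i.+1%:R =
    atan (- r k * sin (2 * pi * u) / (1 + r k * cos (2 * pi * u))) +
    (\sum_(i < M k) (- r k) ^+ i.+1 * sin (i.+1%:R * (2 * pi * u)) / i.+1%:R -
     atan (- r k * sin (2 * pi * u) / (1 + r k * cos (2 * pi * u)))) by ring.
  under eq_fun do rewrite E.
  apply: cvgD; first exact: lima.
  apply/cvgr0Pnorm_le => e e0; near=> k.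
  rewrite distrC; apply: le_trans (dist k u) _.
  near: k; move/cvgr0Pnorm_le: lim0 => /(_ _ e0); apply: filterS => k.
  by rewrite ger0_norm// ltW.
Unshelve. all: by end_near. Qed.

(** At a jump every summand equals 1; elsewhere [sum_cos] keeps the sums bounded, so their averages
    vanish. This expresses the indicator of the jumps by cosines whose expectations are known. *)
Lemma cesaro_cos u :
  (n.+1%:R^-1 * \sum_(i < n.+1) (-1) ^+ i.+1 * cos (i.+1%:R * (2 * pi * u)))
    @[n --> \oo] --> ((1 + cos (2 * pi * u) == 0)%:R : R).
Proof.
case: eqP => [c1|/eqP c0].
  have cE : cos (2 * pi * u) = -1 by apply/eqP; rewrite -addr_eq0 addrC c1.
  have s0 : sin (2 * pi * u) = 0.
    by apply/eqP; rewrite -sqrf_eq0 sin2cos2 cE sqrrN expr1n subrr.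
  have E i : cos (i%:R * (2 * pi * u)) = (-1) ^+ i.
    elim: i => [|i IH]; first by rewrite mul0r cos0.
    by rewrite -natr1 mulrDl mul1r cosD s0 mulr0 subr0 IH cE exprS mulrC.
  apply: cvg_near_cst; near=> n; apply/eqP.
  rewrite (eq_bigr (fun=> 1)) => [|i _]; last by rewrite E -exprD addnn -mul2n exprM sqrrN expr1n expr1n.
  by rewrite sumr_const card_ord mulVf// pnatr_eq0.
(* The 4 in [K] bounds the right-hand side of [sum_cos]: 2 from the pair of cosines, 1 from cos t, 1
   from the constant. *)
apply/cvgr0Pnorm_le => e e0.
pose K := 4 / `|2 + 2 * cos (2 * pi * u)|.
have D0 : 0 < `|2 + 2 * cos (2 * pi * u)|.
  by rewrite normr_gt0 -[2 in X in X + _]mulr1 -mulrDr mulf_neq0.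
have lim : K * n.+1%:R^-1 @[n --> \oo] --> 0.
  by rewrite -(mulr0 K); apply: cvgMr; exact: cvg_harmonic.
near=> n.
have : `|K * n.+1%:R^-1| <= e.
  by near: n; move/cvgr0Pnorm_le: lim; apply.
apply: le_trans; rewrite [`|K * _|]ger0_norm; last first.
  by rewrite mulr_ge0 ?divr_ge0// ltW.
rewrite normrM [`|_^-1|]ger0_norm ?invr_ge0// mulrC ler_wpM2r ?invr_ge0//.
rewrite ler_pdivlMr// mulrC -normrM sum_cos.
apply: le_trans (ler_normB _ _) _; rewrite normr1.
have : `|cos (2 * pi * u)| <= 1 by rewrite ler_norml cos_geN1 cos_le1.
have : `|(-1) ^+ n.+1 * (cos (n.+2%:R * (2 * pi * u)) + cos (n.+1%:R * (2 * pi * u)))| <= 2.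
  rewrite normrM normrX normrN normr1 expr1n mul1r.
  by rewrite ler_norml; apply/andP; split;
    [have := cos_geN1 (n.+2%:R * (2 * pi * u)); have := cos_geN1 (n.+1%:R * (2 * pi * u))|
     have := cos_le1 (n.+2%:R * (2 * pi * u)); have := cos_le1 (n.+1%:R * (2 * pi * u))]; lra.
have := ler_normB ((-1) ^+ n.+1 * (cos (n.+2%:R * (2 * pi * u)) + cos (n.+1%:R * (2 * pi * u)))) (cos (2 * pi * u)).
lra.
Unshelve. all: by end_near. Qed.

End sawtooth.

(** * The sawtooth of a Gaussian vector *)

Section gaussian_expectations.
Context d (T : measurableType d) (R : realType) (P : probability T R).
Local Notation gamma := (@normal_prob R 0 1).

Let gamma_distribution (z : {RV P >-> R}) (h : R -> \bar R) : standard_gaussian z ->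
  (\int[distribution P z]_y h y = \int[distribution gamma (std_gaussian R)]_y h y)%E.
Proof.
by move=> gz; apply: eq_measure_integral => A mA _; exact: gz.
Qed.

(* [std_gaussian R] bridges the two canonical Borel structures on R. *)
Lemma integrable_standard_gaussian (z : {RV P >-> R}) (f : R -> R) :
  standard_gaussian z -> gamma.-integrable setT (EFin \o f) ->
  P.-integrable setT (EFin \o (fun w => f (z w))).
Proof.
move=> gz fi; have mf : measurable_fun setT f := integrableR_measurable fi.
have mfa : measurable_fun setT (fun y : R => `|f y|%:E).
  by apply/measurable_EFinP; exact: measurableT_comp.
apply/integrableP; split; first by apply/measurable_EFinP; exact: measurableT_comp.
case/integrableP: fi => _.
have -> : (\int[gamma]_x `|(EFin \o f) x| =
    \int[distribution gamma (std_gaussian R)]_y `|f y|%:E)%E.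
  by rewrite ge0_integral_distribution.
by rewrite -(gamma_distribution _ gz) ge0_integral_distribution.
Qed.

Lemma Rintegral_standard_gaussian (z : {RV P >-> R}) (f : R -> R) :
  standard_gaussian z -> gamma.-integrable setT (EFin \o f) ->
  \int[P]_w f (z w) = \int[gamma]_y f y.
Proof.
move=> gz fi; have mf : measurable_fun setT f := integrableR_measurable fi.
have mf' : measurable_fun setT (EFin \o f) by exact/measurable_EFinP.
rewrite /Rintegral; congr fine.
have -> : (\int[gamma]_y (f y)%:E =
    \int[distribution gamma (std_gaussian R)]_y (EFin \o f) y)%E.
  by rewrite integral_distribution.
rewrite -(gamma_distribution _ gz) integral_distribution//.
exact: integrable_standard_gaussian.
Qed.

Context (I : finType) (X : I -> {RV P >-> R}).
Hypothesis iX : mutually_independent X.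
Hypothesis gX : forall i, standard_gaussian (X i).

Section blocks.
Variables (J J' : {set I}) (f g : T -> R).
Hypotheses (JJ' : forall i, i \in J -> i \notin J')
  (fJ : depends_on X J f) (gJ' : depends_on X J' g)
  (fi : P.-integrable setT (EFin \o f)) (gi : P.-integrable setT (EFin \o g)).

Let fg A B : measurable A -> measurable B ->
  (P (f @^-1` A `&` g @^-1` B) = P (f @^-1` A) * P (g @^-1` B))%E.
Proof.
by move=> mA mB; apply: (indep_blocks iX JJ'); exact: depends_on_sigma.
Qed.

Lemma integrable_blocksM : P.-integrable setT (EFin \o (fun w => f w * g w)).
Proof. exact: integrable_indepM. Qed.

Lemma Rintegral_blocksM :
  \int[P]_w (f w * g w) = \int[P]_w f w * \int[P]_w g w.
Proof. exact: Rintegral_indepM. Qed.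

End blocks.

Lemma depends_on_linear (J : {set I}) (r : seq I) (s : I -> R) (t : R) :
  {subset r <= J} ->
  depends_on X J (fun w => \sum_(i <- r) s i * X i w + t).
Proof.
move=> rJ; apply: measurable_funD => //.
rewrite (_ : (fun w => _) = (fun w => \sum_(i <- r | i \in J) s i * X i w)); last first.
  apply/funext => w; rewrite big_seq_cond [RHS]big_seq_cond; apply: eq_bigl => i.
  by rewrite andbT; case: (boolP (i \in r)) => // /rJ ->.
elim: r {rJ} => [|i r IH].
  by under eq_fun do rewrite big_nil; exact: measurable_cst.
case: (boolP (i \in J)) => iJ.
  under eq_fun do rewrite big_cons iJ.
  apply: measurable_funD => //; apply: measurable_funM => //.
  exact: depends_on_var.
by under eq_fun do rewrite big_cons (negbTE iJ).
Qed.

Lemma depends_on_comp (J : {set I}) (f : T -> R) (h : R -> R) :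
  depends_on X J f -> measurable_fun setT h -> depends_on X J (fun w => h (f w)).
Proof. by move=> fJ mh; exact: measurableT_comp. Qed.

Let measurable_cos : measurable_fun setT (@cos R).
Proof. exact: (continuous_measurable_fun (@continuous_cos R)). Qed.

Let measurable_sin : measurable_fun setT (@sin R).
Proof. exact: (continuous_measurable_fun (@continuous_sin R)). Qed.

Let integrable_cos f : measurable_fun setT f ->
  P.-integrable setT (EFin \o (fun w => cos (f w))).
Proof.
move=> mf; apply: (@integrableR_bounded _ _ _ _ _ 1).
  exact: measurableT_comp.
by move=> w; rewrite ler_norml cos_geN1 cos_le1.
Qed.

Let affine_measurable (a t : R) : measurable_fun setT (fun x : R => a * x + t).
Proof. by apply: measurable_funD => //; exact: measurable_funM. Qed.

Lemma integrable_std_normal_id : gamma.-integrable setT (EFin \o (fun x : R => x)).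
Proof. by apply: (@integrable_std_normal_le _ _ 5) => //; exact: norm_le_expR4. Qed.

Let integrable_std_normal_xsin (a t : R) :
  gamma.-integrable setT (EFin \o (fun x : R => x * sin (a * x + t))).
Proof.
apply: (@integrable_std_normal_le _ _ 5).
  apply: measurable_funM => //; apply: measurableT_comp => //.
move=> x; rewrite normrM; apply: le_trans (norm_le_expR4 x).
by rewrite ler_piMr// ler_norml sin_geN1 sin_le1.
Qed.

Let integrable_std_normal_cos (a t : R) :
  gamma.-integrable setT (EFin \o (fun x : R => cos (a * x + t))).
Proof.
apply: (@integrable_std_normal_le _ _ 1); first exact: measurableT_comp.
move=> x; rewrite mul1r; apply: le_trans (expR4_ge1 x).
by rewrite ler_norml cos_geN1 cos_le1.
Qed.

Let sinE (y : R) : sin y = cos (y - pi / 2).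
Proof. by rewrite cosB cos_pihalf sin_pihalf mulr0 add0r mulr1. Qed.

(** Induction on the coordinates for all phases at once: a sine is a cosine with phase shifted by -
    pi / 2, so the addition formula stays within the statement. The sine product drops out because
    the head factor carries cos (pi / 2) = 0. *)
Lemma Rintegral_cos_linear (r : seq I) (s : I -> R) (t : R) : uniq r ->
  \int[P]_w cos (\sum_(i <- r) s i * X i w + t) =
  expR (- (\sum_(i <- r) s i ^+ 2 / 2)) * cos t.
Proof.
elim: r t => [|i r IH] t /=.
  move=> _; under eq_Rintegral do rewrite big_nil add0r.
  by rewrite big_nil oppr0 expR0 mul1r Rintegral_cst//= probability_setT mulr1.
move=> /andP[ir ur].
pose V t w := \sum_(j <- r) s j * X j w + t.
have JJ' j : j \in [set i]%SET -> j \notin [set j in r]%SET.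
  by rewrite !inE => /eqP ->.
have Vd t' : depends_on X [set j in r]%SET (V t').
  by apply: depends_on_linear => j jr; rewrite inE.
have mV t' : measurable_fun setT (V t') := depends_on_measurable (Vd t').
have Xd t' : depends_on X [set i]%SET (fun w => s i * X i w + t').
  apply: (depends_on_comp (f := X i) (h := fun x => s i * x + t')) => //.
  apply: depends_on_var.
  by rewrite inE.
have mX t' := depends_on_measurable (Xd t').
transitivity (\int[P]_w (cos (s i * X i w + 0) * cos (V t w) -
                          cos (s i * X i w + - (pi / 2)) * cos (V (t - pi / 2) w))).
  apply: eq_Rintegral => w _; rewrite big_cons -addrA cosD addr0 -/(V t w).
  by rewrite !sinE /V -!addrA.
have dcos J f : depends_on X J f -> depends_on X J (fun w => cos (f w)).
  by move=> fJ; exact: depends_on_comp.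
rewrite RintegralB//; last 2 first.
- by apply: (integrable_blocksM JJ'); [exact: dcos|exact: dcos|exact: integrable_cos|exact: integrable_cos].
- by apply: (integrable_blocksM JJ'); [exact: dcos|exact: dcos|exact: integrable_cos|exact: integrable_cos].
rewrite (Rintegral_blocksM JJ' (dcos _ _ (Xd _)) (dcos _ _ (Vd _)))//; [|exact: integrable_cos|exact: integrable_cos].
rewrite (Rintegral_blocksM JJ' (dcos _ _ (Xd _)) (dcos _ _ (Vd _)))//; [|exact: integrable_cos|exact: integrable_cos].
rewrite /V !IH// !(Rintegral_standard_gaussian (f := fun x => cos (s i * x + _)))//.
rewrite !std_normal_cos cosN cos_pihalf cos0 big_cons mulr0 mul0r subr0 mulr1.
by rewrite mulrA -expRD -opprD.
Qed.

(** The addition formula separates [X j] from the rest. The term with g cos (s_j g) vanishes by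
    oddness, which here is phase pi / 2 in [std_normal_xsin]. *)
Lemma Rintegral_xsin_linear (j : I) (r : seq I) (s : I -> R) : uniq (j :: r) ->
  \int[P]_w (X j w * sin (\sum_(i <- j :: r) s i * X i w)) =
  s j * expR (- (\sum_(i <- j :: r) s i ^+ 2 / 2)).
Proof.
move=> /= /andP[jr ur].
pose V t w := \sum_(j <- r) s j * X j w + t.
have JJ' i : i \in [set j]%SET -> i \notin [set i in r]%SET.
  by rewrite !inE => /eqP ->.
have Vd t' : depends_on X [set j in r]%SET (V t').
  by apply: depends_on_linear => i ir; rewrite inE.
have mV t' : measurable_fun setT (V t') := depends_on_measurable (Vd t').
pose Y t w := X j w * sin (s j * X j w + t).
have Yd t' : depends_on X [set j]%SET (Y t').
  apply: (depends_on_comp (f := X j) (h := fun x => x * sin (s j * x + t'))).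
    by apply: depends_on_var; rewrite inE.
  by apply: measurable_funM => //; exact: measurableT_comp.
have iY t' : P.-integrable setT (EFin \o Y t').
  exact: (integrable_standard_gaussian (f := fun x => x * sin (s j * x + t'))).
transitivity (\int[P]_w (Y 0 w * cos (V 0 w) + Y (pi / 2) w * cos (V (- (pi / 2)) w))).
  apply: eq_Rintegral => w _; rewrite big_cons sinD /Y /V !addr0 sinDpihalf [sin (\sum_(_ <- _) _)]sinE; ring.
have dcos J f : depends_on X J f -> depends_on X J (fun w => cos (f w)).
  by move=> fJ; exact: depends_on_comp.
rewrite RintegralD//; last 2 first.
- by apply: (integrable_blocksM JJ') => //; [exact: dcos|exact: integrable_cos].
- by apply: (integrable_blocksM JJ') => //; [exact: dcos|exact: integrable_cos].
rewrite (Rintegral_blocksM JJ' (Yd _) (dcos _ _ (Vd _)))//; [|exact: integrable_cos].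
rewrite (Rintegral_blocksM JJ' (Yd _) (dcos _ _ (Vd _)))//; [|exact: integrable_cos].
rewrite /V !Rintegral_cos_linear// !(Rintegral_standard_gaussian (f := fun x => x * sin (s j * x + _)))//.
rewrite !std_normal_xsin cos_pihalf cos0 big_cons mulr0 mul0r addr0 !mulr1.
by rewrite -mulrA -expRD -opprD.
Qed.

Lemma measurable_sawtooth : measurable_fun setT (@sawtooth R).
Proof.
apply: measurable_funB => //; apply: nondecreasing_measurable => // x y xy.
by rewrite ler_int ceil_le// lerB.
Qed.

Section sawtooth_mean.
Variables (j : I) (r : seq I) (s : I -> R).
Hypothesis ur : uniq (j :: r).
Let U w := \sum_(i <- j :: r) s i * X i w.
Let A2 := \sum_(i <- j :: r) s i ^+ 2.
Let E := expR (- (2 * pi ^+ 2 * A2)).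
Hypothesis A20 : 0 < A2.

Let mU : measurable_fun setT U.
Proof.
have := @depends_on_linear [set: I]%SET (j :: r) s 0.
move=> /(_ (fun i _ => finset.in_setT i))/depends_on_measurable.
by under eq_fun do rewrite addr0.
Qed.

Let E01 : 0 < E < 1.
Proof.
rewrite expR_gt0/= -expR0 ltr_expR oppr_lt0 mulr_gt0// mulr_gt0//.
by rewrite exprn_gt0// pi_gt0.
Qed.

(** Frequency n + 1 contributes E^((n + 1)^2); weakening the exponent to n + 1 leaves a geometric
    series with sum E / (1 - E). *)
Let expR_freq n :
  expR (- (\sum_(i <- j :: r) (n.+1%:R * (2 * pi) * s i) ^+ 2 / 2)) <= E ^+ n.+1.
Proof.
rewrite /E -expRM_natl ler_expR mulrN lerN2.
under eq_bigr do rewrite exprMn.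
rewrite -mulr_suml -mulr_sumr -/A2.
have n1 : 1 <= (n.+1%:R : R) by rewrite ler1n.
have -> : (n.+1%:R * (2 * pi)) ^+ 2 * A2 / 2 = n.+1%:R * (n.+1%:R * (2 * pi ^+ 2 * A2)) by field.
by rewrite ler_peMl// mulr_ge0// ltW// mulr_gt0// mulr_gt0// exprn_gt0// pi_gt0.
Qed.

Let scaleU n w : n.+1%:R * (2 * pi * U w) =
  \sum_(i <- j :: r) (n.+1%:R * (2 * pi) * s i) * X i w.
Proof. by rewrite !mulr_sumr; apply: eq_bigr => i _; rewrite !mulrA. Qed.

Let sum_geometric n : \sum_(i < n) E ^+ i.+1 <= E / (1 - E).
Proof.
have /andP[E0 E1] := E01.
have E1' : 0 < 1 - E by rewrite subr_gt0.
rewrite ler_pdivlMr// mulrC.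
have -> : (1 - E) * \sum_(i < n) E ^+ i.+1 = E - E ^+ n.+1.
  elim: n => [|n IH]; first by rewrite big_ord0 mulr0 expr1 subrr.
  by rewrite big_ord_recr/= mulrDr IH !exprS; ring.
by rewrite lerBlDr lerDl exprn_ge0// ltW.
Qed.

(* The Cesaro averages of cesaro_cos converge to the indicator of the jumps,
   while their expectations tend to 0. *)
Let jump_null : P [set w | 1 + cos (2 * pi * U w) = 0] = 0%E.
Proof.
set N := [set w | _].
have mN : measurable N.
  rewrite (_ : N = (fun w => 1 + cos (2 * pi * U w)) @^-1` [set 0])//.
  rewrite -[X in measurable X]setTI; apply: (_ : measurable_fun setT _) => //.
  apply: measurable_funD => //; apply: measurableT_comp => //.
  exact: measurable_funM.
pose f n w := n.+1%:R^-1 * \sum_(i < n.+1) (-1) ^+ i.+1 * cos (i.+1%:R * (2 * pi * U w)).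
have icos i : P.-integrable setT (EFin \o (fun w => cos (i.+1%:R * (2 * pi * U w)))).
  by apply: integrable_cos; do 2 apply: measurable_funM => //.
have isum n : P.-integrable setT (EFin \o (fun w => \sum_(i < n.+1) (-1) ^+ i.+1 * cos (i.+1%:R * (2 * pi * U w)))).
  by apply: integrableR_sum => i _; exact: integrableR_Z.
have if_ n : P.-integrable setT (EFin \o f n) by exact: integrableR_Z.
have fE n : \int[P]_w f n w = n.+1%:R^-1 * \sum_(i < n.+1) (-1) ^+ i.+1 *
    expR (- (\sum_(l <- j :: r) (i.+1%:R * (2 * pi) * s l) ^+ 2 / 2)).
  rewrite RintegralZl// Rintegral_sum => [|i _]; last exact: integrableR_Z.
  congr (_ * _); apply: eq_bigr => i _; rewrite RintegralZl//; congr (_ * _).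
  under eq_Rintegral do rewrite scaleU -[X in cos X]addr0.
  by rewrite Rintegral_cos_linear// cos0 mulr1.
have flim : (\int[P]_w f n w) @[n --> \oo] --> (0 : R).
  apply/cvgr0Pnorm_le => e e0.
  have lim : E / (1 - E) * n.+1%:R^-1 @[n --> \oo] --> (0 : R).
    by rewrite -(mulr0 (E / (1 - E))); apply: cvgMr; exact: cvg_harmonic.
  near=> n.
  have : `|E / (1 - E) * n.+1%:R^-1| <= e.
    by near: n; move/cvgr0Pnorm_le: lim; apply.
  apply: le_trans; apply: le_trans (ler_norm _); rewrite fE normrM [`|_^-1|]ger0_norm ?invr_ge0//.
  rewrite mulrC ler_wpM2r ?invr_ge0//; apply: le_trans (sum_geometric n.+1).
  apply: le_trans (ler_norm_sum _ _ _) _; apply: ler_sum => i _.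
  by rewrite normrM normrX normrN normr1 expr1n mul1r ger0_norm ?expR_ge0// expR_freq.
have [|||||_ _ l1] := @dominated_convergence _ _ _ P setT measurableT
  (fun n => EFin \o f n) (EFin \o (\1_N : T -> R)) (fun=> 1%E).
- by move=> n; exact: measurable_int (if_ n).
- by apply/measurable_EFinP; exact: measurable_indic.
- apply: aeW => w _; apply: cvg_EFin; first exact: nearW.
  rewrite indicE; have := @cesaro_cos R (U w).
  suff -> : (w \in N) = (1 + cos (2 * pi * U w) == 0) by [].
  by apply/idP/eqP; rewrite inE.
- exact: finite_measure_integrable_cst.
- apply: aeW => w n _ /=; rewrite lee_fin normrM [`|_^-1|]ger0_norm ?invr_ge0//.
  rewrite ler_pdivrMl// mulr1.
  apply: le_trans (ler_norm_sum _ _ _) _.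
  have -> : n.+1%:R = \sum_(i < n.+1) 1 :> R by rewrite sumr_const card_ord.
  apply: ler_sum => i _.
  by rewrite normrM normrX normrN normr1 expr1n mul1r ler_norml cos_geN1 cos_le1.
have l0 : (\int[P]_x (f n x)%:E)%E @[n --> \oo] --> 0%E.
  have -> : (fun n => \int[P]_x (f n x)%:E)%E = (fun n => (\int[P]_x f n x)%:E).
    apply/funext => n; rewrite /Rintegral fineK//.
    exact: (integrable_fin_num measurableT (if_ n)).
  by apply: cvg_EFin => //; exact: nearW.
have : (\int[P]_x (EFin \o (\1_N : T -> R)) x)%E = 0%E by exact: (cvg_unique _ l1 l0).
by rewrite /= integral_indic// setIT.
Unshelve. all: by end_near. Qed.

(** In each term the Fourier coefficient c / (pi n) meets the factor 2 pi n s_j of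
    [Rintegral_xsin_linear], so n cancels and 2 c s_j remains with |c| <= 1. The resulting bound is
    uniform in the Abel mean and survives dominated convergence under |X_j|. *)
Lemma sawtooth_mean_le :
  `|\int[P]_w (X j w * sawtooth (U w))| <= 2 * `|s j| * (E / (1 - E)).
Proof.
have [M [c [c1 p1 plim]]] := sawtooth_approx R.
pose p k w := \sum_(i < M k) c k i / (pi * i.+1%:R) * sin (i.+1%:R * (2 * pi * U w)).
have pi0 := @pi_gt0 R.
have mp k : measurable_fun setT (p k).
  apply: measurable_sum => i; apply: measurable_funM => //.
  by apply: measurableT_comp => //; do 2 apply: measurable_funM => //.
have iXj : P.-integrable setT (EFin \o (fun w => X j w)).
  exact: (integrable_standard_gaussian (f := fun x => x) (gX j) integrable_std_normal_id).
have iabs : P.-integrable setT (EFin \o (fun w => `|X j w|)).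
  by have := integrable_abse iXj.
have ixsin i : P.-integrable setT (EFin \o (fun w => X j w * sin (i.+1%:R * (2 * pi * U w)))).
  apply: (integrableR_le (g := fun w => `|X j w|)) => //.
    apply: measurable_funM => //; apply: measurableT_comp => //.
    by do 2 apply: measurable_funM => //.
  by move=> w; rewrite normrM ler_piMr// ler_norml sin_geN1 sin_le1.
have pE k : \int[P]_w (X j w * p k w) = \sum_(i < M k) 2 * c k i * s j *
    expR (- (\sum_(l <- j :: r) (i.+1%:R * (2 * pi) * s l) ^+ 2 / 2)).
  transitivity (\int[P]_w (\sum_(i < M k) c k i / (pi * i.+1%:R) * (X j w * sin (i.+1%:R * (2 * pi * U w))))).
    by apply: eq_Rintegral => w _; rewrite mulr_sumr; apply: eq_bigr => i _; rewrite mulrCA.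
  rewrite Rintegral_sum => [|i _]; last exact: integrableR_Z.
  apply: eq_bigr => i _; rewrite RintegralZl//.
  under eq_Rintegral do rewrite scaleU.
  rewrite Rintegral_xsin_linear//; move: (expR _) (lt0r_neq0 pi0) => e.
  by move: (@pi R) => q q0; field; rewrite nat1r pnatr_eq0.
have pbound k : `|\int[P]_w (X j w * p k w)| <= 2 * `|s j| * (E / (1 - E)).
  rewrite pE; apply: le_trans (ler_norm_sum _ _ _) _.
  apply: le_trans (ler_wpM2l _ (sum_geometric (M k))); last by rewrite mulr_ge0.
  rewrite mulr_sumr; apply: ler_sum => i _.
  rewrite !normrM [`|expR _|]ger0_norm ?expR_ge0// [`|2|]ger0_norm//.
  apply: ler_pM; [by rewrite !mulr_ge0|exact: expR_ge0| |exact: expR_freq].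
  by rewrite ler_wpM2r// ler_piMr.
have [|||||_ _ l1] := @dominated_convergence _ _ _ P setT measurableT
  (fun k => EFin \o (fun w => X j w * p k w))
  (EFin \o (fun w => X j w * sawtooth (U w))) (EFin \o (fun w => `|X j w|)).
- by move=> k; apply/measurable_EFinP; exact: measurable_funM.
- apply/measurable_EFinP; apply: measurable_funM => //.
  exact: measurableT_comp measurable_sawtooth mU.
(* The Abel means converge off the jumps, which [jump_null] shows to be negligible. *)
- exists [set w | 1 + cos (2 * pi * U w) = 0]; split => //.
    rewrite (_ : [set w | _] = (fun w => 1 + cos (2 * pi * U w)) @^-1` [set 0])//.
    rewrite -[X in measurable X]setTI; apply: (_ : measurable_fun setT _) => //.
    apply: measurable_funD => //; apply: measurableT_comp => //.
    exact: measurable_funM.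
  move=> w /=; apply: contra_notP => /eqP c0 _.
  apply: cvg_EFin; first exact: nearW.
  by apply: cvgMr; exact: plim.
- exact: iabs.
- apply: aeW => w k _ /=; rewrite lee_fin normrM ler_piMr//; exact: p1.
have isaw : P.-integrable setT (EFin \o (fun w => X j w * sawtooth (U w))).
  apply: (integrableR_le (g := fun w => `|X j w|)) => //.
    by apply: measurable_funM => //; exact: measurableT_comp measurable_sawtooth mU.
  move=> w; rewrite normrM ler_piMr// ler_norml.
  by have := sawtooth_itv (U w); move=> /andP[? ?]; apply/andP; split; lra.
have l2 : (\int[P]_w (X j w * p k w)) @[k --> \oo] --> \int[P]_w (X j w * sawtooth (U w)).
  apply: fine_cvg; rewrite fineK//; exact: integrable_fin_num.
by apply: (cvgr_to_le (cvg_norm l2)); exact: nearW.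
Qed.

End sawtooth_mean.

End gaussian_expectations.

(** * Concentration *)

Section mgf.
Context d (T : measurableType d) (R : realType) (P : probability T R).
Local Notation gamma := (@normal_prob R 0 1).

Definition gaussian_exp_moment (R : realType) : R :=
  \int[@normal_prob R 0 1]_x expR (x ^+ 2 / 4).

Lemma gaussian_exp_moment_ge1 : 1 <= gaussian_exp_moment R.
Proof.
have <- : \int[gamma]_x 1 = 1 :> R.
  by rewrite Rintegral_cst//= mul1r probability_setT.
apply: le_Rintegral => //.
- exact: finite_measure_integrable_cst.
- exact: integrable_std_normal_expR.
- by move=> x _; exact: expR4_ge1.
Qed.

(** For y >= 0 the bound exp y <= 1 + y exp y, inserted into itself, gives the second-order form. *)
Lemma expR_le_quadratic (y : R) : expR y <= 1 + y + y ^+ 2 * expR `|y|.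
Proof.
have h (z : R) : 0 <= z -> expR z <= 1 + z * expR z.
  move=> z0; have := expR_ge1Dx (- z); have := expRxMexpNx_1 z.
  have := expR_gt0 z; have := expR_gt0 (- z).
  by move: (expR z) (expR (- z)) => a b *; nra.
have [y0|y0] := leP 0 y.
  rewrite ger0_norm//; have := h _ y0; have := h _ y0.
  have := expR_ge1Dx y; move: (expR y) => a *; nra.
rewrite ltr0_norm//; have := expR_ge1Dx (- y); have := expRxMexpNx_1 y.
have := expR_ge1Dx y; have := expR_gt0 y; have := expR_gt0 (- y).
move: (expR y) (expR (- y)) => a b *.
nra.
Qed.

Variables (z1 z2 : {RV P >-> R}).
Hypotheses (g1 : standard_gaussian z1) (g2 : standard_gaussian z2).

(** An integrable majorant of exp (|Y| / 4) when |Y| <= 1 + (z1^2 + z2^2) / 2, by the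
    arithmetic-geometric mean inequality. It makes sense for dependent or equal [z1] and [z2]. *)
Let dom w := expR (4^-1) * ((expR (z1 w ^+ 2 / 4) + expR (z2 w ^+ 2 / 4)) / 2).

Let iz (z : {RV P >-> R}) : standard_gaussian z ->
  P.-integrable setT (EFin \o (fun w => expR (z w ^+ 2 / 4))).
Proof.
move=> gz; apply: (integrable_standard_gaussian (f := fun x => expR (x ^+ 2 / 4))) => //.
exact: integrable_std_normal_expR.
Qed.

Let Ez (z : {RV P >-> R}) : standard_gaussian z ->
  \int[P]_w expR (z w ^+ 2 / 4) = gaussian_exp_moment R.
Proof.
move=> gz; rewrite (Rintegral_standard_gaussian (f := fun x => expR (x ^+ 2 / 4)))//.
exact: integrable_std_normal_expR.
Qed.

Let domE w : dom w = expR (4^-1) / 2 * (expR (z1 w ^+ 2 / 4) + expR (z2 w ^+ 2 / 4)).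
Proof. by rewrite /dom; ring. Qed.

Let idom : P.-integrable setT (EFin \o dom).
Proof.
rewrite (_ : dom = fun w => expR (4^-1) / 2 * (expR (z1 w ^+ 2 / 4) + expR (z2 w ^+ 2 / 4))); last first.
  exact/funext/domE.
by apply: integrableR_Z; apply: integrableR_D; exact: iz.
Qed.

Let Edom : \int[P]_w dom w = expR (4^-1) * gaussian_exp_moment R.
Proof.
under eq_Rintegral do rewrite domE.
rewrite RintegralZl//; last by apply: integrableR_D; exact: iz.
by rewrite RintegralD ?iz// !Ez//; field.
Qed.

(* E exp(sY) <= 1 + s^2 * const: the linear term vanishes as Y is centred, and
   the quadratic one is controlled by E exp(|Y|/4), hence by E exp(g^2/4). *)
Lemma mgf_le (Y : T -> R) (s : R) : measurable_fun setT Y ->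
  (forall w, `|Y w| <= 1 + (z1 w ^+ 2 + z2 w ^+ 2) / 2) ->
  \int[P]_w Y w = 0 -> `|s| <= 8^-1 ->
  P.-integrable setT (EFin \o (fun w => expR (s * Y w))) /\
  \int[P]_w expR (s * Y w) <=
    expR (256 * (expR (4^-1) * gaussian_exp_moment R) * s ^+ 2).
Proof.
move=> mY Yle EY s8.
have domY w : expR (`|Y w| / 4) <= dom w.
  apply: (@le_trans _ _ (expR (4^-1 + (z1 w ^+ 2 / 4 / 2 + z2 w ^+ 2 / 4 / 2)))).
    by rewrite ler_expR; have := Yle w; lra.
  rewrite expRD /dom ler_pM2l ?expR_gt0//.
  set a := z1 w ^+ 2 / 4; set b := z2 w ^+ 2 / 4.
  have ea : expR a = expR (a / 2) ^+ 2 by rewrite expr2 -expRD; congr expR; field.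
  have eb : expR b = expR (b / 2) ^+ 2 by rewrite expr2 -expRD; congr expR; field.
  rewrite expRD ea eb; have := sqr_ge0 (expR (a / 2) - expR (b / 2)).
  by rewrite sqrrB; lra.
have sY w : `|s * Y w| <= `|Y w| / 8.
  by rewrite normrM mulrC ler_wpM2l.
have iE : P.-integrable setT (EFin \o (fun w => expR (s * Y w))).
  apply: (integrableR_le (g := dom)) => //.
    by apply: measurableT_comp => //; exact: measurable_funM.
  move=> w; rewrite ger0_norm ?expR_ge0//; apply: le_trans (domY w).
  rewrite ler_expR; apply: le_trans (ler_norm _) _; apply: le_trans (sY w) _.
  by have := normr_ge0 (Y w); lra.
have iY : P.-integrable setT (EFin \o Y).
  apply: (integrableR_le (g := fun w => 4 * dom w)) => //; last exact: integrableR_Z.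
  move=> w; have := domY w; have := expR_ge1Dx (`|Y w| / 4); lra.
split => //.
have key w : expR (s * Y w) <= 1 + s * Y w + 256 * s ^+ 2 * dom w.
  apply: le_trans (expR_le_quadratic _) _; rewrite lerD2l.
  have e8 : expR (`|Y w| / 8) ^+ 2 <= dom w.
    rewrite expr2 -expRD; apply: le_trans (domY w).
    by rewrite ler_expR; have := normr_ge0 (Y w); lra.
  (* The 256 is 16^2, from |Y| / 16 <= exp (|Y| / 16). The other half of the budget exp (|Y| / 4)
     pays for exp |s Y|, as |s| <= 1 / 8. *)
  have y8 : `|Y w| ^+ 2 <= 256 * expR (`|Y w| / 8).
    have := expR_ge1Dx (`|Y w| / 16).
    have -> : expR (`|Y w| / 8) = expR (`|Y w| / 16) ^+ 2.
      by rewrite expr2 -expRD; congr expR; field.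
    have := normr_ge0 (Y w); move: (expR _) => a b c; nra.
  have es : expR `|s * Y w| <= expR (`|Y w| / 8) by rewrite ler_expR.
  rewrite exprMn -[Y w ^+ 2]real_normK ?num_real//.
  rewrite mulrAC [leRHS]mulrC mulrA -mulrA.
  have -> : s ^+ 2 * expR `|s * Y w| * `|Y w| ^+ 2 = s ^+ 2 * (`|Y w| ^+ 2 * expR `|s * Y w|) by ring.
  have -> : dom w * (256 * s ^+ 2) = s ^+ 2 * (256 * dom w) by ring.
  rewrite ler_wpM2l ?sqr_ge0//.
  apply: (@le_trans _ _ (256 * expR (`|Y w| / 8) * expR (`|Y w| / 8))).
    by apply: ler_pM => //.
  by rewrite -mulrA -expr2 ler_wpM2l.
apply: (@le_trans _ _ (\int[P]_w (1 + s * Y w + 256 * s ^+ 2 * dom w))).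
  apply: le_Rintegral => //.
  apply: integrableR_D; last exact: integrableR_Z.
  by apply: integrableR_D; [exact: finite_measure_integrable_cst|exact: integrableR_Z].
rewrite RintegralD//; last 2 first.
- by apply: integrableR_D; [exact: finite_measure_integrable_cst|exact: integrableR_Z].
- exact: integrableR_Z.
rewrite RintegralD//; last 2 first.
- exact: finite_measure_integrable_cst.
- exact: integrableR_Z.
have -> : \int[P]_w (s * Y w) = 0 by rewrite RintegralZl// EY mulr0.
have -> : \int[P]_w (256 * s ^+ 2 * dom w) =
    256 * s ^+ 2 * (expR (4^-1) * gaussian_exp_moment R) by rewrite RintegralZl// Edom.
rewrite addr0 Rintegral_cst//= probability_setT mulr1.
apply: le_trans (expR_ge1Dx _); rewrite lerD2l.
by rewrite mulrAC.
Qed.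

End mgf.

(** The coefficient of s^2 in the exponent of [mgf_le]. *)
Definition chernoff_cst (R : realType) : R :=
  256 * (expR (4^-1) * gaussian_exp_moment R).

Lemma chernoff_cst_ge4 (R : realType) : 4 <= chernoff_cst R.
Proof.
have : 1 <= expR (4^-1) * gaussian_exp_moment R.
  rewrite mulr_ege1 ?gaussian_exp_moment_ge1//.
  by rewrite -expR0 ler_expR.
rewrite /chernoff_cst; move: (_ * gaussian_exp_moment R) => D; lra.
Qed.

Section chernoff.
Context d (T : measurableType d) (R : realType) (P : probability T R).
Variables (m N : nat) (X : 'I_m * 'I_N -> {RV P >-> R}).
Hypothesis iX : mutually_independent X.
Hypothesis gX : forall p, standard_gaussian (X p).

Definition row_block (i : 'I_m) : {set 'I_m * 'I_N} := [set p | p.1 == i]%SET.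

Variables (j l : 'I_N) (Y : 'I_m -> T -> R).
Hypothesis Yrow : forall i, depends_on X (row_block i) (Y i).
Hypothesis Yle : forall i w,
  `|Y i w| <= 1 + (X (i, j) w ^+ 2 + X (i, l) w ^+ 2) / 2.
Hypothesis EY : forall i, \int[P]_w Y i w = 0.

Let C := chernoff_cst R.

Let C_ge : 4 <= C := chernoff_cst_ge4 R.

Let mY i : measurable_fun setT (Y i).
Proof.
by apply: (@depends_on_measurable _ _ _ P _ X (row_block i)); exact: Yrow.
Qed.

(** The three claims are proved together because factoring off one row requires integrability and
    block dependence of the remaining product. *)
Let mgf_sum (s : R) (r : seq 'I_m) : uniq r -> `|s| <= 8^-1 ->
  [/\ P.-integrable setT (EFin \o (fun w => expR (s * \sum_(i <- r) Y i w))),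
      depends_on X [set p | p.1 \in r]%SET (fun w => expR (s * \sum_(i <- r) Y i w)) &
      \int[P]_w expR (s * \sum_(i <- r) Y i w) <= expR (C * s ^+ 2 * (size r)%:R)].
Proof.
move=> + s8; elim: r => [_|i r IH /= /andP[ir ur]].
  have E : (fun w : T => expR (s * \sum_(i <- [::]) Y i w)) = (fun=> 1).
    by apply/funext => w; rewrite big_nil mulr0 expR0.
  split.
  - by rewrite E; exact: finite_measure_integrable_cst.
  - by rewrite E; exact: measurable_cst.
  - by rewrite E Rintegral_cst//= probability_setT mulr0 expR0 mulr1.
have [ii dd le] := IH ur.
have [iYi leYi] := mgf_le (gX (i, j)) (gX (i, l)) (mY i) (Yle i) (EY i) s8.
have E : (fun w : T => expR (s * \sum_(k <- i :: r) Y k w)) =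
    (fun w => expR (s * Y i w) * expR (s * \sum_(k <- r) Y k w)).
  by apply/funext => w; rewrite big_cons mulrDr expRD.
have dYi : depends_on X (row_block i) (fun w => expR (s * Y i w)).
  apply: (depends_on_comp (h := fun y => expR (s * y))); first exact: Yrow.
  by apply: measurableT_comp => //; exact: measurable_funM.
have JJ' p : p \in row_block i -> p \notin [set p : 'I_m * 'I_N | p.1 \in r]%SET.
  by rewrite !inE => /eqP ->.
split.
- by rewrite E; exact: (integrable_blocksM iX JJ').
- rewrite E; apply: measurable_funM.
    apply: depends_onS dYi; apply/fintype.subsetP => p; rewrite !inE => /eqP ->.
    by rewrite eqxx.
  apply: depends_onS dd; apply/fintype.subsetP => p; rewrite !inE => ->.
  by rewrite orbT.
- under eq_Rintegral do rewrite big_cons mulrDr expRD.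
  rewrite (Rintegral_blocksM iX JJ')// -natr1 mulrDr mulr1 addrC expRD.
  by apply: ler_pM => //; apply: Rintegral_ge0 => w _; exact: expR_ge0.
Qed.

(** Exponential Markov inequality. Keeping [s] on both sides of the event allows a negative [s], so
    one statement serves both tails. *)
Let tail (s t : R) : `|s| <= 8^-1 ->
  (P [set w | (s * t * m%:R <= s * \sum_i Y i w)%R] <= (expR (m%:R * (C * s ^+ 2 - s * t)))%:E)%E.
Proof.
move=> s8; have [ii _ le] := mgf_sum (index_enum_uniq _) s8.
set A := [set w | _].
have mS : measurable_fun setT (fun w => s * \sum_i Y i w).
  by apply: measurable_funM => //; exact: measurable_sum.
have mA : measurable A.
  by rewrite (_ : A = (fun w => s * \sum_i Y i w) @^-1` `[s * t * m%:R, +oo[%classic);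
    [rewrite -[X in measurable X]setTI; exact: mS|apply/seteqP; split => w /=; rewrite in_itv/= andbT].
rewrite -[P A]fineK ?fin_num_measure// lee_fin.
have -> : fine (P A) = \int[P]_w (\1_A w).
  by rewrite /Rintegral integral_indic// setIT.
apply: (@le_trans _ _ (\int[P]_w (expR (- (s * t * m%:R)) * expR (s * \sum_i Y i w)))).
  apply: le_Rintegral => //.
  - apply: (@integrableR_bounded _ _ _ _ _ 1); first exact: measurable_indic.
    by move=> w; rewrite indicE; case: (_ \in _); rewrite ?normr1 ?normr0.
  - exact: integrableR_Z.
  - move=> w _; rewrite -expRD indicE; case: (boolP (w \in A)) => [|_]; last exact: expR_ge0.
    by rewrite inE /A/= => wA; rewrite -[X in X <= _]expR0 ler_expR addrC subr_ge0.
rewrite RintegralZl//; apply: le_trans (ler_wpM2l (expR_ge0 _) le) _.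
rewrite -expRD ler_expR /index_enum -enumT size_enum_ord; lra.
Qed.

(* The exponent is that of the exponential Markov bound at s = t / (2 C). *)
Lemma row_sum_tail (t : R) : 0 <= t <= 1 ->
  (P [set w | (t * m%:R <= `|\sum_i Y i w|)%R] <=
   (2 * expR (- (m%:R * t ^+ 2 / (4 * chernoff_cst R))))%:E)%E.
Proof.
move=> /andP[t0 t1]; rewrite -/C.
have C0 : 0 < C by apply: lt_le_trans C_ge.
have mS : measurable_fun setT (fun w => \sum_i Y i w) by exact: measurable_sum.
(* [e] is the sign of the tail. The parameter t / (2 C) is admissible since C >= 4 and t <= 1 put it
   below 1 / 8. *)
have half (e : R) : `|e| = 1 ->
    measurable [set w | e * (t / (2 * C)) * (e * t) * m%:R <= e * (t / (2 * C)) * \sum_i Y i w] /\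
    (P [set w | (e * (t / (2 * C)) * (e * t) * m%:R <= e * (t / (2 * C)) * \sum_i Y i w)%R] <=
     (expR (- (m%:R * t ^+ 2 / (4 * C))))%:E)%E.
  move=> e1; have e2 : e * e = 1 by rewrite -expr2 -[e ^+ 2]real_normK ?num_real// e1 expr1n.
  split.
    set A := (X in measurable X).
    rewrite (_ : A = (fun w => e * (t / (2 * C)) * \sum_i Y i w) @^-1`
        `[e * (t / (2 * C)) * (e * t) * m%:R, +oo[%classic); last first.
      by apply/seteqP; split => w /=; rewrite in_itv/= andbT.
    rewrite -[X in measurable X]setTI; apply: (_ : measurable_fun setT _) => //.
    exact: measurable_funM.
  have -> : - (m%:R * t ^+ 2 / (4 * C)) =
      m%:R * (C * (e * (t / (2 * C))) ^+ 2 - e * (t / (2 * C)) * (e * t)).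
    have -> : C * (e * (t / (2 * C))) ^+ 2 - e * (t / (2 * C)) * (e * t) =
        (e * e) * (C * (t / (2 * C)) ^+ 2 - (t / (2 * C)) * t) by ring.
    by rewrite e2; field; rewrite gt_eqF.
  have C20 : 0 < 2 * C by rewrite mulr_gt0.
  apply: tail; rewrite normrM e1 mul1r ger0_norm; last by rewrite divr_ge0// ltW.
  by rewrite ler_pdivrMr//; move: C_ge; move: (C) => D; lra.
have [m1 p1] := half 1 (normr1 _).
have [m2 p2] := half (-1) (normrN1 _).
have mA : measurable [set w | t * m%:R <= `|\sum_i Y i w|].
  rewrite (_ : [set w | _] = (fun w => `|\sum_i Y i w|) @^-1` `[t * m%:R, +oo[%classic); last first.
    by apply/seteqP; split => w /=; rewrite in_itv/= andbT.
  rewrite -[X in measurable X]setTI; apply: (_ : measurable_fun setT _) => //.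
  exact: measurableT_comp.
apply: (@le_trans _ _ (P ([set w | 1 * (t / (2 * C)) * (1 * t) * m%:R <= 1 * (t / (2 * C)) * \sum_i Y i w] `|`
   [set w | -1 * (t / (2 * C)) * (-1 * t) * m%:R <= -1 * (t / (2 * C)) * \sum_i Y i w]))).
  apply: le_measure; rewrite ?inE//; first exact: measurableU.
  have k0 : 0 <= t / (2 * C) by rewrite divr_ge0// mulr_ge0// ltW.
  move=> w /= h; have [S0|S0] := leP 0 (\sum_i Y i w).
    left; rewrite ger0_norm// in h.
    by rewrite !mul1r -mulrA ler_wpM2l.
  right; rewrite ltr0_norm// in h.
  have -> : -1 * (t / (2 * C)) * (-1 * t) * m%:R = t / (2 * C) * (t * m%:R) by ring.
  have -> : -1 * (t / (2 * C)) * \sum_i Y i w = t / (2 * C) * - \sum_i Y i w by ring.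
  exact: ler_wpM2l.
apply: le_trans (measureU2 _ m1 m2) _.
have D (z : R) : (2 * z)%:E = (z%:E + z%:E)%E by rewrite -EFinD; congr EFin; ring.
by rewrite D; exact: leeD.
Qed.

End chernoff.

(** * The two-stage method on a well-conditioned matrix *)

Section deterministic.
Context (R : realType).

(** Expanding the sum of the squares of D a_i - S b_i gives D (D A - S^2) >= 0; the case D = 0 is
    separate because D is cancelled. *)
Lemma cauchy_schwarz (I : finType) (Q : pred I) (a b : I -> R) :
  \sum_(i | Q i) a i * b i <=
  Num.sqrt (\sum_(i | Q i) a i ^+ 2) * Num.sqrt (\sum_(i | Q i) b i ^+ 2).
Proof.
set A := \sum_(i | Q i) a i ^+ 2; set D := \sum_(i | Q i) b i ^+ 2.
set S := \sum_(i | Q i) a i * b i.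
have A0 : 0 <= A by apply: sumr_ge0 => i _; exact: sqr_ge0.
have D0 : 0 <= D by apply: sumr_ge0 => i _; exact: sqr_ge0.
have : 0 <= \sum_(i | Q i) (D * a i - S * b i) ^+ 2.
  by apply: sumr_ge0 => i _; exact: sqr_ge0.
have -> : \sum_(i | Q i) (D * a i - S * b i) ^+ 2 = D * (D * A - S ^+ 2).
  rewrite (eq_bigr (fun i => D ^+ 2 * a i ^+ 2 - 2 * D * S * (a i * b i) + S ^+ 2 * b i ^+ 2)).
    by rewrite big_split sumrB/= -!mulr_sumr -/A -/D -/S; ring.
  by move=> i _; ring.
move=> h; rewrite -sqrtrM//.
have [D00|Dn0] := eqVneq D 0.
  have b0 i : Q i -> b i = 0.
    move=> Qi; apply/eqP; rewrite -sqrf_eq0; apply/eqP.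
    have /allP/(_ i (mem_index_enum _)) : all (fun i => Q i ==> (b i ^+ 2 == 0)) (index_enum I).
      by rewrite -psumr_eq0 => [|j _]; [exact/eqP|exact: sqr_ge0].
    by move/implyP/(_ Qi)/eqP.
  suff -> : S = 0 by exact: sqrtr_ge0.
  by apply: big1 => i Qi; rewrite b0// mulr0.
have Dp : 0 < D by rewrite lt_neqAle eq_sym Dn0.
apply: le_trans (ler_norm S) _; rewrite -sqrtr_sqr ler_wsqrtr//.
by move: h; rewrite pmulr_rge0// subr_ge0 mulrC.
Qed.

Variables (m N : nat) (Phi : 'M[R]_(m, N)).
Implicit Types u v : 'cV[R]_N.

Let sq n (v : 'cV[R]_n) := \sum_(i < n) v i 0 ^+ 2.

Lemma norm2_sqr n (v : 'cV[R]_n) : norm2 v ^+ 2 = \sum_(i < n) v i 0 ^+ 2.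
Proof. by rewrite sqr_sqrtr// sumr_ge0// => i _; exact: sqr_ge0. Qed.

Hypothesis gram : forall j l,
  `|\sum_i Phi i j * Phi i l - m%:R * (j == l)%:R| <= m%:R * (4 * N%:R)^-1.

(** The entrywise error m / (4 N) changes the quadratic form by at most m / (4 N) times the squared
    l1 norm, which is at most N times [sq v]; the loss is m / 4. *)
Lemma gram_lower v : 3 / 4 * m%:R * sq v <= sq (Phi *m v).
Proof.
have [N0|N0] := posnP N.
  have -> : sq v = 0.
    rewrite /sq big1// => i _.
    by have : (i < 0)%N by rewrite -[X in (_ < X)%N]N0.
  by rewrite mulr0; apply: sumr_ge0 => i _; exact: sqr_ge0.
have E : sq (Phi *m v) = \sum_j \sum_l v j 0 * v l 0 * \sum_i Phi i j * Phi i l.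
  transitivity (\sum_i \sum_j \sum_l v j 0 * v l 0 * (Phi i j * Phi i l)).
    apply: eq_bigr => i _; rewrite mxE expr2 mulr_suml; apply: eq_bigr => j _.
    by rewrite mulr_sumr; apply: eq_bigr => l _; ring.
  rewrite exchange_big/=; apply: eq_bigr => j _.
  by rewrite exchange_big/=; apply: eq_bigr => l _; rewrite mulr_sumr.
have D : m%:R * sq v = \sum_j \sum_l v j 0 * v l 0 * (m%:R * (j == l)%:R).
  rewrite /sq mulr_sumr; apply: eq_bigr => j _.
  rewrite (bigD1 j)//= eqxx mulr1 big1 ?addr0 => [|l lj]; first by rewrite expr2 mulrC.
  by rewrite eq_sym (negbTE lj) !mulr0.
have n1 : (\sum_j `|v j 0|) ^+ 2 <= N%:R * sq v.
  have := cauchy_schwarz xpredT (fun j => `|v j 0|) (fun=> 1).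
  under eq_bigr do rewrite mulr1.
  under [X in _ <= Num.sqrt X * _ -> _]eq_bigr do rewrite real_normK ?num_real//.
  rewrite expr1n sumr_const card_ord -/(sq v) => h.
  have s0 : 0 <= \sum_j `|v j 0| by apply: sumr_ge0.
  have sv : 0 <= sq v by apply: sumr_ge0 => j _; exact: sqr_ge0.
  rewrite -ler_sqrt ?mulr_ge0// sqrtr_sqr ger0_norm// sqrtrM ?ler0n//.
  by rewrite mulrC.
have dist : m%:R * sq v - sq (Phi *m v) <= m%:R * (4 * N%:R)^-1 * (\sum_j `|v j 0|) ^+ 2.
  rewrite E D -sumrB expr2 mulr_suml mulr_sumr; apply: ler_sum => j _.
  rewrite -sumrB 2!mulr_sumr; apply: ler_sum => l _.
  rewrite -mulrBr; apply: le_trans (ler_norm _) _.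
  rewrite !normrM distrC [leRHS]mulrC ler_wpM2l ?mulr_ge0//.
have : m%:R * (4 * N%:R)^-1 * (\sum_j `|v j 0|) ^+ 2 <= m%:R / 4 * sq v.
  apply: (@le_trans _ _ (m%:R * (4 * N%:R)^-1 * (N%:R * sq v))).
    by rewrite ler_wpM2l// mulr_ge0// invr_ge0 mulr_ge0.
  suff -> : m%:R * (4 * N%:R)^-1 * (N%:R * sq v) = m%:R / 4 * sq v by [].
  by field; rewrite pnatr_eq0 -lt0n.
move: dist; move: (m%:R * (4 * N%:R)^-1 * _) (sq (Phi *m v)) => a b.
by move: (sq v) => c; lra.
Qed.

Variables (k : nat) (delta : R) (x xM : 'cV[R]_N) (b t : R).
Hypotheses (m0 : (0 < m)%N) (delta0 : 0 < delta) (cardx : #|supp x| = k)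
  (xlarge : forall j, j \in supp x -> 5 * delta <= `|x j 0|)
  (b0 : 0 <= b) (t0 : 0 <= t).
Hypothesis corr : forall j, j \in supp x ->
  `|\sum_i Phi i j * sawtooth ((Phi *m x) i 0 / delta)| <=
  m%:R * (b * `|x j 0| + t).

Let q := msq delta (Phi *m x).
Let m0' : 0 < (m%:R : R). Proof. by rewrite ltr0n. Qed.

Let residual i : q i 0 - (Phi *m x) i 0 = delta * sawtooth ((Phi *m x) i 0 / delta).
Proof.
rewrite mxE /quantizer /sawtooth mulrBr [delta * (_ / _)]mulrCA divff ?gt_eqF//.
by rewrite mulr1 mulrC.
Qed.

(** Both [xs] and [x] have images within squared distance m delta^2 / 4 of [q], so Phi (xs - x) has
    squared norm at most m delta^2, and [gram_lower] leaves 4 / 3 delta^2 < (2 delta)^2. *)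
Let stage1 xs : l1_solution Phi q delta xs -> forall j, `|xs j 0 - x j 0| < 2 * delta.
Proof.
move=> [feas _] j.
have sa : sq (Phi *m xs - q) <= m%:R * delta ^+ 2 / 4.
  rewrite -[sq _]norm2_sqr; apply: (@le_trans _ _ ((Num.sqrt m%:R * delta / 2) ^+ 2)).
    rewrite ler_pXn2r// nnegrE ?sqrtr_ge0// divr_ge0// mulr_ge0 ?sqrtr_ge0//.
    exact: ltW.
  by rewrite expr_div_n exprMn sqr_sqrtr//; lra.
have sb : sq (q - Phi *m x) <= m%:R * delta ^+ 2 / 4.
  rewrite /sq; apply: (@le_trans _ _ (\sum_(i < m) delta ^+ 2 / 4)); last first.
    by rewrite sumr_const card_ord -[X in X <= _]mulr_natl mulrA.
  apply: ler_sum => i _; rewrite [(q - _) i 0]mxE [(- (Phi *m x)) i 0]mxE residual.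
  have /andP[s1 s2] := sawtooth_itv ((Phi *m x) i 0 / delta).
  rewrite exprMn ler_wpM2l ?sqr_ge0//; move: (sawtooth _) s1 s2 => s s1 s2; nra.
have sc : sq (Phi *m (xs - x)) <= m%:R * delta ^+ 2.
  apply: (@le_trans _ _ (2 * sq (Phi *m xs - q) + 2 * sq (q - Phi *m x))).
    rewrite /sq !mulr_sumr -big_split/=; apply: ler_sum => i _.
    have -> : (Phi *m (xs - x)) i 0 = (Phi *m xs - q) i 0 + (q - Phi *m x) i 0.
      by rewrite mulmxBr !mxE; ring.
    move: ((Phi *m xs - q) i 0) ((q - Phi *m x) i 0) => a c.
    by have := sqr_ge0 (a - c); lra.
  by move: sa sb; move: (sq _) (sq _) => *; lra.
have sd : sq (xs - x) <= 4 / 3 * delta ^+ 2.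
  have := le_trans (gram_lower (xs - x)) sc.
  by move: (sq _) (delta ^+ 2) => a c h; rewrite -(ler_pM2l m0'); lra.
have : (xs j 0 - x j 0) ^+ 2 <= sq (xs - x).
  rewrite /sq (bigD1 j)//= !mxE lerDl; apply: sumr_ge0 => i _; exact: sqr_ge0.
move=> /le_trans/(_ sd); rewrite -real_normK ?num_real// => h.
rewrite -(ltr_pXn2r (ltn0Sn 1)) ?nnegrE ?mulr_ge0 ?(ltW delta0)//.
apply: le_lt_trans h _; rewrite exprMn.
by have := exprn_gt0 2 delta0; lra.
Qed.

(** By equal cardinalities, an index missed by [S] forces a spurious one in it. But [xs] exceeds 3
    delta on the support and stays below 2 delta off it. *)
Let support_recovered xs (S : {set 'I_N}) : l1_solution Phi q delta xs ->
  largest_entries k xs S -> S = supp x.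
Proof.
move=> l1 [cS lS]; have close := stage1 l1.
apply/esym/eqP; rewrite eqEcard cS cardx leqnn andbT.
apply/fintype.subsetP => j jx; apply/negP => /negP jS.
have /subsetPn[i iS ix] : ~~ (S \subset supp x).
  apply/negP => Sx; have : S == supp x by rewrite eqEcard Sx cS cardx leqnn.
  by move=> /eqP E; rewrite E jx in jS.
have := lS i j iS jS; have := close i; have := close j; have := xlarge jx.
have := lerB_dist (x j 0) (xs j 0); rewrite [X in _ <= X]distrC.
have -> : x i 0 = 0 by move: ix; rewrite inE negbK => /eqP.
rewrite subr0.
have absurd (a c e f g : R) : 0 < g ->
  a - c <= e -> 5 * g <= a -> e < 2 * g -> f < 2 * g -> c <= f -> False by lra.
exact: (absurd _ _ _ _ _ delta0).
Qed.

(** The error e lives on the true support, so the normal equations give |Phi e|^2 = <e, Phi^T (q -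
    Phi x)>, linear in e with coefficients bounded by [corr]. [gram_lower] makes the left side at
    least 3 / 4 m |e|^2, and one factor |e| cancels. *)
Lemma two_stage_error : two_stage k delta Phi q xM ->
  norm2 (xM - x) <= 4 / 3 * delta * (b * norm2 x + t * Num.sqrt k%:R).
Proof.
move=> [xs [S [l1 lS xMS xMq]]].
have SE := support_recovered l1 lS; pose e := xM - x.
have out v : supp v \subset S -> forall j, j \notin S -> v j 0 = 0.
  move=> /fintype.subsetP vS j jS; apply/eqP/negbNE/negP => vj.
  by move/negP: jS; apply; apply: vS; rewrite inE.
have xS : supp x \subset S by rewrite SE.
have restrictE v : supp v \subset S -> columns S Phi *m Defs.restrict S v = Phi *m v.
  move=> vS; apply/colP => i; rewrite !mxE.
  rewrite [RHS](bigID (fun j => j \in S))/= [X in _ + X]big1 ?addr0; last first.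
    by move=> j jS; rewrite (out v)// mulr0.
  rewrite [RHS]big_enum_val/=; apply: eq_bigr => j _; by rewrite !mxE.
have normal j : j \in S -> \sum_i Phi i j * (Phi *m e) i 0 =
    \sum_i Phi i j * (q i 0 - (Phi *m x) i 0).
  (* The normal equations follow from the Penrose conditions: symmetry of M M^+ and M M^+ M = M give
     M^T M M^+ = M^T, whatever the rank of M. *)
  move=> jS; pose M := columns S Phi.
  have [p1 _ p3 _] := mp_pinvP M.
  have : M^T *m (M *m (Defs.restrict S xM)) = M^T *m q.
    by rewrite xMq -/M (mulmxA M) -p3 (mulmxA M^T) -trmx_mul p1.
  rewrite restrictE// => /matrixP/(_ (enum_rank_in jS j) 0).
  rewrite !mxE => h.
  have F w : \sum_i (M^T) (enum_rank_in jS j) i * w i 0 = \sum_i Phi i j * w i 0.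
    by apply: eq_bigr => i _; rewrite !mxE enum_rankK_in.
  rewrite !F in h.
  under eq_bigr do rewrite mulmxBr !mxE mulrBr.
  under [RHS]eq_bigr do rewrite mulrBr.
  by rewrite !sumrB -h; congr (_ - _); apply: eq_bigr => i _; rewrite mxE.
have e_out j : j \notin S -> e j 0 = 0.
  by move=> jS; rewrite !mxE (out xM)// (out x)// subrr.
have sqE : sq (Phi *m e) = \sum_(j in S) e j 0 * (delta *
    \sum_i Phi i j * sawtooth ((Phi *m x) i 0 / delta)).
  transitivity (\sum_j e j 0 * \sum_i Phi i j * (Phi *m e) i 0).
    under [RHS]eq_bigr do rewrite mulr_sumr.
    rewrite exchange_big/=; apply: eq_bigr => i _.
    rewrite expr2 {1}mxE mulr_suml; apply: eq_bigr => j _; ring.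
  rewrite (bigID (fun j => j \in S))/= [X in _ + X]big1 ?addr0; last first.
    by move=> j jS; rewrite e_out// mul0r.
  apply: eq_bigr => j jS; rewrite normal//; congr (_ * _).
  by rewrite mulr_sumr; apply: eq_bigr => i _; rewrite residual mulrCA.
have sumS (F : 'I_N -> R) : (forall j, 0 <= F j) -> \sum_(j in S) F j <= \sum_j F j.
  move=> F0; rewrite [leRHS](bigID (fun j => j \in S))/= lerDl.
  exact: sumr_ge0.
have ub : sq (Phi *m e) <= m%:R * delta * (norm2 e * (b * norm2 x + t * Num.sqrt k%:R)).
  rewrite sqE; apply: (@le_trans _ _ (\sum_(j in S) m%:R * delta *
      (b * (`|e j 0| * `|x j 0|) + t * (`|e j 0| * 1)))).
    apply: ler_sum => j jS; apply: le_trans (ler_norm _) _.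
    rewrite !normrM (gtr0_norm delta0).
    apply: (@le_trans _ _ (`|e j 0| * (delta * (m%:R * (b * `|x j 0| + t))))).
      by rewrite ler_wpM2l// ler_wpM2l ?(ltW delta0)//; apply: corr; rewrite -SE.
    by rewrite le_eqVlt; apply/orP; left; apply/eqP; ring.
  rewrite -mulr_sumr ler_wpM2l ?mulr_ge0 ?(ltW delta0)//.
  rewrite big_split/= -!mulr_sumr mulrDr lerD//.
    rewrite mulrCA ler_wpM2l//; apply: le_trans (cauchy_schwarz _ _ _) _.
    apply: ler_pM; rewrite ?sqrtr_ge0// ler_wsqrtr//;
      (apply: le_trans (sumS _ _) _ => [j|]; first exact: sqr_ge0);
      by apply: ler_sum => j _; rewrite real_normK ?num_real.
  rewrite mulrCA ler_wpM2l//; apply: le_trans (cauchy_schwarz _ _ _) _.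
  apply: ler_pM; rewrite ?sqrtr_ge0// ler_wsqrtr//.
    (apply: le_trans (sumS _ _) _ => [j|]; first exact: sqr_ge0).
    by apply: ler_sum => j _; rewrite real_normK ?num_real.
  by rewrite expr1n sumr_const SE cardx.
have := le_trans (gram_lower e) ub.
rewrite -[sq e]norm2_sqr.
have [->|en0] := eqVneq (norm2 e) 0.
  move=> _; rewrite mulr_ge0//; first by rewrite mulr_ge0 ?(ltW delta0)// divr_ge0.
  by rewrite addr_ge0// mulr_ge0// sqrtr_ge0.
have e0 : 0 < norm2 e by rewrite lt_neqAle eq_sym en0 sqrtr_ge0.
move: (norm2 e) e0 (_ + _) => n n0 D h.
rewrite -(ler_pM2l (mulr_gt0 m0' n0)).
move: h; have -> : m%:R * delta * (n * D) = 3 / 4 * (m%:R * n * (4 / 3 * delta * D)) by field.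
have -> : 3 / 4 * m%:R * n ^+ 2 = 3 / 4 * (m%:R * n * n) by ring.
have p : 0 < 3 / 4 :> R by lra.
by rewrite (ler_pM2l p).
Qed.

End deterministic.

(** * Measurability and probability of finite unions of bad events *)

Section union_bound.
Context d (T : measurableType d) (R : realType) (P : probability T R).

Lemma measurable_norm_ge (f : T -> R) (c : R) : measurable_fun setT f ->
  measurable [set w | c <= `|f w|].
Proof.
move=> mf; rewrite (_ : [set w | _] = (fun w => `|f w|) @^-1` `[c, +oo[%classic); last first.
  by apply/seteqP; split => w /=; rewrite in_itv/= andbT.
rewrite -[X in measurable X]setTI; apply: (_ : measurable_fun setT _) => //.
exact: measurableT_comp.
Qed.

Lemma union_bound (I : Type) (r : seq I) (B : I -> set T) (c : R) :
  (forall i, measurable (B i)) -> (forall i, (P (B i) <= c%:E)%E) ->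
  measurable (\big[setU/set0]_(i <- r) B i) /\
  (P (\big[setU/set0]_(i <- r) B i) <= ((size r)%:R * c)%:E)%E.
Proof.
move=> mB Bc; elim: r => [|i r [mr rc]].
  by rewrite big_nil mul0r measure0; split.
rewrite big_cons; split; first exact: measurableU.
apply: le_trans (measureU2 _ (mB i) mr) _.
by rewrite /= -natr1 mulrDl mul1r addrC EFinD; exact: leeD.
Qed.

End union_bound.

(** * Concentration of the Gram matrix and of the residual correlations *)

Section empirical_means.
Context d (T : measurableType d) (R : realType) (P : probability T R).
Variables (m N : nat) (Phi : 'I_m -> 'I_N -> {RV P >-> R}).
Hypothesis gPhi : gaussian_matrix Phi.
Let X (p : 'I_m * 'I_N) : {RV P >-> R} := Phi p.1 p.2.
Let gX p : standard_gaussian (X p). Proof. by case: gPhi => g _; exact: g. Qed.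
Let iX : mutually_independent X. Proof. by case: gPhi. Qed.
Local Notation gamma := (@normal_prob R 0 1).

Let integrable_X p : P.-integrable setT (EFin \o (fun w => X p w)).
Proof.
exact: (integrable_standard_gaussian (f := fun x => x) (gX p) (integrable_std_normal_id R)).
Qed.

Let integrable_X2 p : P.-integrable setT (EFin \o (fun w => X p w ^+ 2)).
Proof.
apply: (integrable_standard_gaussian (f := fun x => x ^+ 2) (gX p)).
apply: (@integrable_std_normal_le _ _ 4); first exact: measurable_funX.
by move=> x; rewrite ger0_norm ?sqr_ge0//; exact: sqr_le_expR4.
Qed.

Let mean_X p : \int[P]_w X p w = 0.
Proof.
rewrite (Rintegral_standard_gaussian (f := fun x => x) (gX p) (integrable_std_normal_id R)).
(* Frequency 0 and phase pi / 2 turn the sine into the constant 1. *)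
have E0 := std_normal_xsin (0 : R) (pi / 2).
rewrite cos_pihalf mulr0 in E0; rewrite -[RHS]E0.
by apply: eq_Rintegral => x _; rewrite mul0r add0r sin_pihalf mulr1.
Qed.

Let mean_X2 p : \int[P]_w (X p w ^+ 2) = 1.
Proof.
rewrite (Rintegral_standard_gaussian (f := fun x => x ^+ 2) (gX p)) ?std_normal_sqr//.
apply: (@integrable_std_normal_le _ _ 4); first exact: measurable_funX.
by move=> x; rewrite ger0_norm ?sqr_ge0//; exact: sqr_le_expR4.
Qed.

Let X_row i j : depends_on X (row_block N i) (fun w => X (i, j) w).
Proof. by apply: (depends_on_var (X := X)); rewrite inE. Qed.

(** The centred products of two entries of a row fit the envelope of [row_sum_tail] because |a b| <=
    (a^2 + b^2) / 2. Their mean is the unit variance for j = l and vanishes by independence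
    otherwise. *)
Lemma gram_concentration j l (t : R) : 0 <= t <= 1 ->
  measurable [set w | t * m%:R <= `|\sum_i (Phi i j w * Phi i l w - (j == l)%:R)|] /\
  (P [set w | (t * m%:R <= `|\sum_i (Phi i j w * Phi i l w - (j == l)%:R)|)%R] <=
   (2 * expR (- (m%:R * t ^+ 2 / (4 * chernoff_cst R))))%:E)%E.
Proof.
move=> t01; pose Y i w := X (i, j) w * X (i, l) w - (j == l)%:R.
have Yd i : depends_on X (row_block N i) (Y i).
  apply: measurable_funB => //.
  by apply: measurable_funM; exact: X_row.
split.
  apply: measurable_norm_ge; apply: measurable_sum => i.
  exact: (depends_on_measurable (Yd i)).
apply: (row_sum_tail iX gX (j := j) (l := l) (Y := Y)) => // i.
  move=> w; apply: le_trans (ler_normB _ _) _; rewrite addrC lerD//.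
    by case: eqP => _; rewrite ?normr1 ?normr0.
  rewrite normrM; move: (X (i, j) w) (X (i, l) w) => a b.
  rewrite -[a ^+ 2]real_normK ?num_real// -[b ^+ 2]real_normK ?num_real//.
  have := sqr_ge0 (`|a| - `|b|); move: (`|a|) (`|b|) => c e; nra.
rewrite /Y; case: (eqVneq j l) => [<-|jl].
  rewrite RintegralB//; last 2 first.
  - by have := integrable_X2 (i, j); under eq_fun do rewrite expr2.
  - exact: finite_measure_integrable_cst.
  under eq_Rintegral do rewrite -expr2.
  by rewrite mean_X2 Rintegral_cst//= probability_setT mulr1 subrr.
have JJ' p : p \in [set (i, j)]%SET -> p \notin [set (i, l)]%SET.
  by rewrite !inE => /eqP ->; rewrite xpair_eqE eqxx/=.
have dX p : depends_on X [set p]%SET (X p).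
  by apply: depends_on_var; rewrite inE.
under eq_Rintegral do rewrite subr0.
by rewrite (Rintegral_blocksM iX JJ')// !mean_X mulr0.
Qed.

Variables (x : 'cV[R]_N) (delta : R).
Hypotheses (delta0 : 0 < delta) (x0 : 0 < norm2 x).
Let U i w := (\sum_l Phi i l w * x l 0) / delta.
Let E := expR (- (2 * pi ^+ 2 * (norm2 x ^+ 2 / delta ^+ 2))).

Let U_row i : depends_on X (row_block N i) (U i).
Proof.
apply: measurable_funM => //; apply: measurable_sum => l.
by apply: measurable_funM => //; exact: X_row.
Qed.

Let mU i : measurable_fun setT (U i).
Proof. exact: (depends_on_measurable (@U_row i)). Qed.

Let XU_row i j : depends_on X (row_block N i) (fun w => X (i, j) w * sawtooth (U i w)).
Proof.
apply: measurable_funM; first exact: X_row.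
apply: measurableT_comp; last exact: U_row.
exact: measurable_sawtooth.
Qed.

Let integrable_XU i j : P.-integrable setT (EFin \o (fun w => X (i, j) w * sawtooth (U i w))).
Proof.
apply: (integrableR_le (g := fun w => `|X (i, j) w|)).
- exact: (depends_on_measurable (@XU_row i j)).
- move=> w; rewrite normrM ler_piMr// ler_norml.
  by have /andP[? ?] := sawtooth_itv (U i w); apply/andP; split; lra.
- by have := integrable_abse (integrable_X (i, j)).
Qed.

Let mean_XU_le i j :
  `|\int[P]_w (X (i, j) w * sawtooth (U i w))| <= 2 * `|x j 0 / delta| * (E / (1 - E)).
Proof.
(* Row [i] is listed with column [j] first, as [sawtooth_mean_le] singles out the head variable. *)
pose r := [seq (i, l) | l <- rem j (enum 'I_N)].
pose s (p : 'I_m * 'I_N) := x p.2 0 / delta.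
have perm : perm_eq (index_enum 'I_N) (j :: rem j (enum 'I_N)).
  rewrite /index_enum -enumT; apply: perm_to_rem; exact: mem_enum.
have ur : uniq ((i, j) :: r).
  rewrite -[(i, j) :: r]/[seq (i, l) | l <- j :: rem j (enum 'I_N)].
  rewrite map_inj_uniq => [|a b []//].
  by rewrite -(perm_uniq perm) index_enum_uniq.
have sumE (F : 'I_m * 'I_N -> R) : \sum_(p <- (i, j) :: r) F p = \sum_l F (i, l).
  rewrite -[(i, j) :: r]/[seq (i, l) | l <- j :: rem j (enum 'I_N)] big_map.
  by apply/esym/perm_big.
have A2 : \sum_(p <- (i, j) :: r) s p ^+ 2 = norm2 x ^+ 2 / delta ^+ 2.
  rewrite sumE norm2_sqr mulr_suml; apply: eq_bigr => l _.
  by rewrite /s expr_div_n.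
have A20 : 0 < \sum_(p <- (i, j) :: r) s p ^+ 2.
  by rewrite A2 divr_gt0// exprn_gt0.
have := sawtooth_mean_le iX gX ur A20; rewrite A2 -/E.
congr (`|_| <= _); apply: eq_Rintegral => w _; congr (_ * sawtooth _).
rewrite sumE /U mulr_suml; apply: eq_bigr => l _.
by rewrite /s/= /X/=; ring.
Qed.

(** A crude bound on the mean, needed to keep the centred summands inside the envelope of
    [row_sum_tail]; it follows from |X| / 2 <= (1 + X^2) / 4. *)
Let mean_XU_half i j : `|\int[P]_w (X (i, j) w * sawtooth (U i w))| <= 2^-1.
Proof.
apply: le_trans (le_normr_Rintegral _ (integrable_XU i j)) _ => //.
apply: (@le_trans _ _ (\int[P]_w (4^-1 * (1 + X (i, j) w ^+ 2)))).
  have i1 : P.-integrable setT (EFin \o (fun w => 1 + X (i, j) w ^+ 2)).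
    by apply: integrableR_D => //; exact: finite_measure_integrable_cst.
  apply: le_Rintegral => //.
  - by have := integrable_abse (integrable_XU i j).
  - exact: integrableR_Z.
  - move=> w _; rewrite normrM.
    apply: (@le_trans _ _ (`|X (i, j) w| * 2^-1)).
      rewrite ler_wpM2l// ler_norml.
      by have /andP[? ?] := sawtooth_itv (U i w); apply/andP; split; lra.
    rewrite -[X (i, j) w ^+ 2]real_normK ?num_real//.
    by have := sqr_ge0 (`|X (i, j) w| - 1); move: (`|X (i, j) w|) => a; nra.
rewrite RintegralZl//; last first.
  by apply: integrableR_D => //; exact: finite_measure_integrable_cst.
rewrite RintegralD//; last exact: finite_measure_integrable_cst.
rewrite mean_X2 Rintegral_cst//= probability_setT mulr1; lra.
Qed.

Lemma correlation_concentration j (t : R) : 0 <= t <= 1 -> exists B : set T,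
  [/\ measurable B,
      (P B <= (2 * expR (- (m%:R * t ^+ 2 / (4 * chernoff_cst R))))%:E)%E &
      forall w, ~ B w -> `|\sum_i Phi i j w * sawtooth (U i w)| <=
        m%:R * (2 / delta * (E / (1 - E)) * `|x j 0| + t)].
Proof.
move=> t01; pose b i := \int[P]_w (X (i, j) w * sawtooth (U i w)).
pose Y i w := X (i, j) w * sawtooth (U i w) - b i.
have Yd i : depends_on X (row_block N i) (Y i).
  by apply: measurable_funB => //; exact: XU_row.
exists [set w | t * m%:R <= `|\sum_i Y i w|]; split.
- apply: measurable_norm_ge; apply: measurable_sum => i.
  exact: (depends_on_measurable (Yd i)).
(* With both columns equal to [j] the envelope is 1 + X^2, which exceeds |X| / 2 + 1 / 2. *)
- apply: (row_sum_tail iX gX (j := j) (l := j) (Y := Y)) => // i.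
    move=> w; apply: le_trans (ler_normB _ _) _.
    have := mean_XU_half i j; rewrite -/(b i) normrM.
    have : `|X (i, j) w| * `|sawtooth (U i w)| <= `|X (i, j) w| * 2^-1.
      rewrite ler_wpM2l// ler_norml.
      by have /andP[? ?] := sawtooth_itv (U i w); apply/andP; split; lra.
    rewrite -[X (i, j) w ^+ 2]real_normK ?num_real//.
    move: (`|X (i, j) w|) (normr_ge0 (X (i, j) w)) (_ * `|sawtooth _|) (`|b i|) => a a0 c e.
    by have := sqr_ge0 (a - 1); nra.
  rewrite RintegralB//; last exact: finite_measure_integrable_cst.
  by rewrite Rintegral_cst//= probability_setT mulr1 subrr.
- move=> w /= /negP; rewrite -ltNge => /ltW h.
  have -> : \sum_i Phi i j w * sawtooth (U i w) = \sum_i Y i w + \sum_i b i.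
    by rewrite -big_split/=; apply: eq_bigr => i _; rewrite /Y subrK.
  apply: le_trans (ler_normD _ _) _; rewrite mulrDr addrC lerD//; last by rewrite mulrC.
  apply: le_trans (ler_norm_sum _ _ _) _.
  apply: (@le_trans _ _ (\sum_(i < m) 2 / delta * (E / (1 - E)) * `|x j 0|)).
    apply: ler_sum => i _; apply: le_trans (mean_XU_le i j) _.
    by rewrite normrM normfV (gtr0_norm delta0) le_eqVlt; apply/orP; left; apply/eqP; ring.
  by rewrite sumr_const card_ord -[X in X <= _]mulr_natl.
Qed.

End empirical_means.

(** * Error bound with high probability *)

(** Used when lambda <= 5: it gives exp (5 c6) exp (- c6 lambda^alpha) >= 1. *)
Lemma powR_le5 (R : realType) (lambda alpha : R) : 0 <= lambda <= 5 ->
  0 <= alpha <= 1 -> lambda `^ alpha <= 5.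
Proof.
move=> /andP[l0 l5] /andP[a0 a1].
apply: (@le_trans _ _ (5 `^ alpha)); first by apply: ge0_ler_powR; rewrite ?nnegrE//; lra.
apply: (@le_trans _ _ (5 `^ 1)); first by apply: ler_powR => //; lra.
by rewrite powRr1.
Qed.

Lemma inv_sqr_half_ge4 (R : realType) (s : R) : 0 <= s < 2^-1 -> 4 <= (2^-1 - s) ^- 2.
Proof.
move=> /andP[s0 s2]; have p : 0 < (2^-1 - s) ^+ 2 by rewrite exprn_gt0// subr_gt0.
by rewrite -[4]invrK lef_pV2 ?posrE ?invr_gt0//; nra.
Qed.

Lemma powR_half_lt (R : realType) (l : R) : 5 < l -> l `^ (- 2^-1) < 2^-1.
Proof.
move=> l5; rewrite powRN powR12_sqrt ?ltf_pV2 ?posrE ?sqrtr_gt0; try lra.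
have -> : 2 = Num.sqrt (2 ^+ 2) :> R by rewrite sqrtr_sqr ger0_norm.
by rewrite ltr_sqrt//; lra.
Qed.

Lemma expRN_le23 (R : realType) (y : R) : 1 <= y -> expR (- y) <= 2 / 3.
Proof.
move=> y1; have := expR_ge1Dx y; have := expRxMexpNx_1 y.
by have := expR_gt0 (- y); move: y1; move: (expR y) (expR (- y)) => a b *; nra.
Qed.

(** The geometric tail costs e / (1 - e) <= 3 e, exactly the range e <= 2 / 3. Then 4 / 3 * 2 * 3 =
    8 = 4 * 2: the factor 4, a lower bound for A, is used up in the first term. *)
Lemma error_slack (R : realType) (n e delta t s : R) :
  0 <= n -> 0 < e <= 2 / 3 -> 0 < delta -> 0 <= t -> 0 <= s ->
  4 / 3 * delta * (2 / delta * (e / (1 - e)) * n + t * s) <=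
  4 * (2 * n * e + s * t * delta).
Proof.
move=> n0 /andP[e0 e23] d0 t0 s0.
have ee : e / (1 - e) <= 3 * e by rewrite ler_pdivrMr; [nra|lra].
move: (e / (1 - e)) ee => z ee.
have -> : 4 / 3 * delta * (2 / delta * z * n + t * s) =
    8 / 3 * (n * z) + 4 / 3 * (s * t * delta) by field; rewrite gt_eqF.
have := ler_wpM2l n0 ee.
have : 0 <= s * t * delta by rewrite !mulr_ge0// ltW.
by move: (s * t * delta) (n * z) => q nz; rewrite mulrCA; lra.
Qed.

Theorem corollary4p2 (R : realType) (K : R)
    (hK : (subgaussian_norm (std_gaussian R) <= K%:E)%E) :
  exists2 cK : R, 0 < cK &
  forall k : nat, (3 <= k)%N ->
  exists2 C : R, 0 < C &
  exists2 c4 : R -> R, (forall alpha, 0 <= alpha < 2^-1 -> 0 < c4 alpha) &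
  forall (N : nat) (x : 'cV[R]_N), sparse k x -> #|supp x| = k ->
  exists c5 c6 c7 : R, [/\ 0 < c5, 0 < c6, 0 < c7 &
  forall (alpha delta : R) (m : nat) (d : measure_display)
    (Omega : measurableType d) (P : probability Omega R)
    (Phi : 'I_m -> 'I_N -> {RV P >-> R}) (xMSQ : Omega -> 'cV[R]_N),
  0 <= alpha < 2^-1 ->
  0 < delta ->
  (forall j, j \in supp x -> C * delta <= `|x j 0|) ->
  gaussian_matrix Phi ->
  let lambda := m%:R / k%:R in
  c4 alpha * ln N%:R <= lambda ->
  (forall w, two_stage k delta (draw Phi w) (msq delta (draw Phi w *m x))
               (xMSQ w)) ->
  let A := (2^-1 - cK * lambda `^ (- 2^-1)) ^- 2 in
  exists E : set Omega,
    [/\ measurable E,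
        forall w, E w ->
          norm2 (xMSQ w - x) <=
            A * (2 * norm2 x *
                   expR (- (2 * pi ^+ 2 * norm2 x ^+ 2 / delta ^+ 2)) +
                 c7 * Num.sqrt (ln k%:R) *
                   lambda `^ (- ((1 - alpha) / 2)) * delta) &
        ((1 - c5 * expR (- (c6 * lambda `^ alpha)))%:E <= P E)%E]].
Proof.
(* [cK] = 1 gives A >= 4 as soon as lambda > 4, and [C] = 5 is the gap used in support recovery.
   Since [c5] and [c6] may depend on [x], hence on [N], they absorb the dimension, and [c4] can be
   constant. *)
exists 1 => // k k3; exists 5 => //; exists (fun=> 1) => // N x _ cardx.
have [H HE] : exists H, H = chernoff_cst R by exists (chernoff_cst R).
have H0 : 0 < H by rewrite HE; apply: lt_le_trans (chernoff_cst_ge4 R).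
have kpos : 0 < (k%:R : R) by rewrite ltr0n; apply: leq_trans k3.
have N0 : 0 < (N%:R : R).
  rewrite ltr0n; apply: (@leq_trans k); first exact: leq_trans k3.
  by rewrite -cardx -[X in (_ <= X)%N]card_ord max_card.
pose eps : R := (4 * N%:R)^-1.
have eps0 : 0 < eps by rewrite invr_gt0 mulr_gt0.
have N1 : 1 <= (N%:R : R) by rewrite ler1n -(ltr0n R).
have eps1 : eps <= 1 by rewrite invf_le1; lra.
have lnk : 0 < Num.sqrt (ln k%:R) :> R.
  by rewrite sqrtr_gt0 ln_gt0// ltr1n; apply: leq_trans k3.
(* The Gram tail has exponent m eps^2 / (4 H) = c6 lambda >= c6 lambda^alpha. The correlation tail
   has exponent k lambda^alpha / (4 H), at least c6 lambda^alpha because eps <= 1. *)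
pose c6 : R := k%:R * eps ^+ 2 / (4 * H).
(* N^2 Gram events and N correlation events, each with a two-sided tail of factor 2; the extra exp
   (5 c6) in [c5] covers lambda <= 5. *)
pose nbad : R := (N * N + N)%:R.
pose c5 : R := 2 * nbad + expR (5 * c6).
(* [two_stage_error] produces the square root of k; the quotient rewrites it in the required form
   with log k, which is positive since k >= 3. *)
pose c7 : R := Num.sqrt k%:R / Num.sqrt (ln k%:R).
have c60 : 0 < c6 by rewrite /c6 divr_gt0// mulr_gt0// exprn_gt0.
have nbad0 : 0 <= nbad by exact: ler0n.
exists c5, c6, c7; split => //.
- by rewrite /c5; have := expR_gt0 (5 * c6); lra.
- by rewrite divr_gt0// sqrtr_gt0.
move=> alpha delta m d Omega P Phi xMSQ /andP[a0 a1] delta0 xlarge gPhi lambda _ xM A.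
have lambda0 : 0 <= lambda by rewrite divr_ge0// ltW.
(* Here the claimed probability is at most 0, so the empty event will do. *)
have [lambda5|lambda5] := leP lambda 5.
  exists set0; split => //.
  rewrite measure0 lee_fin subr_le0.
  apply: (@le_trans _ _ (expR (5 * c6) * expR (- (c6 * lambda `^ alpha)))); last first.
    by rewrite ler_wpM2r ?expR_ge0// /c5 lerDr mulr_ge0.
  rewrite -expRD -[X in X <= _]expR0 ler_expR subr_ge0 mulrC ler_wpM2r ?(ltW c60)//.
  by apply: powR_le5; apply/andP; split => //; lra.
have lpos : 0 < lambda by lra.
have m0 : (0 < m)%N.
  by rewrite lt0n; apply/eqP => m0; move: lpos; rewrite /lambda m0 mul0r ltxx.
have mE : m%:R = k%:R * lambda by rewrite /lambda mulrCA divff ?mulr1// gt_eqF.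
pose t := lambda `^ (- ((1 - alpha) / 2)).
have t0 : 0 <= t by exact: powR_ge0.
have t1 : t <= 1.
  rewrite -(powRr0 lambda); apply: ler_powR; lra.
have t01 : 0 <= t <= 1 by rewrite t0.
have t2 : m%:R * t ^+ 2 = k%:R * lambda `^ alpha.
  rewrite mE -mulrA expr2 -powRD ?(gt_eqF lpos) ?implybT//.
  congr (_ * _); rewrite -[X in X * _](powRr1 lambda0).
  by rewrite -powRD ?(gt_eqF lpos) ?implybT//; congr (_ `^ _); field.
have eps01 : 0 <= eps <= 1 by rewrite (ltW eps0).
have la : lambda `^ alpha <= lambda.
  by rewrite -[X in _ <= X](powRr1 lambda0); apply: ler_powR; lra.
pose bd := 2 * expR (- (c6 * lambda `^ alpha)).
have bd1 : 2 * expR (- (m%:R * eps ^+ 2 / (4 * H))) <= bd.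
  rewrite /bd ler_pM2l// ler_expR lerN2 mE /c6.
  have -> : k%:R * lambda * eps ^+ 2 / (4 * H) = k%:R * eps ^+ 2 / (4 * H) * lambda by ring.
  by apply: ler_wpM2l => //; exact: ltW c60.
have bd2 : 2 * expR (- (m%:R * t ^+ 2 / (4 * H))) <= bd.
  rewrite /bd ler_pM2l// ler_expR lerN2 t2 /c6.
  have -> : k%:R * eps ^+ 2 / (4 * H) * lambda `^ alpha =
     eps ^+ 2 * (k%:R * lambda `^ alpha / (4 * H)) by ring.
  rewrite ler_piMl//; last by rewrite exprn_ile1// ltW.
  by rewrite divr_ge0 ?mulr_ge0 ?powR_ge0// ltW.
have [j0 j0x] : exists j, j \in supp x.
  by apply/set0Pn; rewrite -card_gt0 cardx; apply: leq_trans k3.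
(* One entry of the support already gives |x| >= 5 delta. Hence x is nonzero and the leading
   exponential [e] is far below 2 / 3. *)
have x25 : 25 * delta ^+ 2 <= norm2 x ^+ 2.
  rewrite norm2_sqr (bigD1 j0)//= -[X in X <= _]addr0 lerD//; last first.
    by apply: sumr_ge0 => i _; exact: sqr_ge0.
  rewrite -[x j0 0 ^+ 2]real_normK ?num_real//.
  have -> : 25 * delta ^+ 2 = (5 * delta) ^+ 2 by ring.
  have xl := xlarge j0 j0x.
  by rewrite ler_pXn2r ?nnegrE// mulr_ge0// ltW.
have d20 : 0 < delta ^+ 2 by exact: exprn_gt0.
have xpos : 0 < norm2 x.
  rewrite lt_neqAle sqrtr_ge0 andbT eq_sym; apply/eqP => E; move: x25.
  by rewrite E expr0n/=; lra.
pose e := expR (- (2 * pi ^+ 2 * (norm2 x ^+ 2 / delta ^+ 2))).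
have e23 : e <= 2 / 3.
  apply: expRN_le23; have y25 : 25 <= norm2 x ^+ 2 / delta ^+ 2 by rewrite ler_pdivlMr.
  by have p2 := @pi_ge2 R; nra.
have e0 : 0 < e by exact: expR_gt0.
have /choice[B2 B2P] := fun j => correlation_concentration gPhi delta0 xpos j t01.
pose B1 (p : 'I_N * 'I_N) := [set w | eps * m%:R <=
   `|\sum_i (Phi i p.1 w * Phi i p.2 w - (p.1 == p.2)%:R)|].
have mB1 p : measurable (B1 p) by have [] := gram_concentration gPhi p.1 p.2 eps01.
have PB1 p : (P (B1 p) <= bd%:E)%E.
  have [_ h] := gram_concentration gPhi p.1 p.2 eps01.
  by apply: (le_trans h); rewrite lee_fin -HE.
have mB2 j : measurable (B2 j) by have [] := B2P j.
have PB2 j : (P (B2 j) <= bd%:E)%E.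
  by have [_ h _] := B2P j; apply: (le_trans h); rewrite lee_fin -HE.
have [mU1 PU1] := union_bound (index_enum _) mB1 PB1.
have [mU2 PU2] := union_bound (index_enum _) mB2 PB2.
set U1 := \big[setU/set0]_(i <- _) B1 i in mU1 PU1.
set U2 := \big[setU/set0]_(i <- _) B2 i in mU2 PU2.
exists (~` (U1 `|` U2)); split.
- by apply: measurableC; exact: measurableU.
- move=> w /= /not_orP[nU1 nU2].
  have gram j l : `|\sum_i draw Phi w i j * draw Phi w i l - m%:R * (j == l)%:R|
      <= m%:R * (4 * N%:R)^-1.
    have : ~ B1 (j, l) w by move=> h; apply: nU1; rewrite /U1 (bigD1_seq (j, l)) ?mem_index_enum ?index_enum_uniq//=; left.
    move=> /negP; rewrite -ltNge => /ltW; rewrite [X in _ -> _ <= X]mulrC; apply: le_trans.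
    rewrite /= sumrB sumr_const card_ord -[(_ == _)%:R *+ m]mulr_natl.
    by under eq_bigr do rewrite !mxE.
  have corr j : j \in supp x ->
    `|\sum_i draw Phi w i j * sawtooth ((draw Phi w *m x) i 0 / delta)| <=
      m%:R * (2 / delta * (e / (1 - e)) * `|x j 0| + t).
    move=> _; have [_ _ h] := B2P j.
    have nB : ~ B2 j w by move=> h'; apply: nU2; rewrite /U2 (bigD1_seq j) ?mem_index_enum ?index_enum_uniq//=; left.
    have := h w nB; rewrite -/e; congr (`|_| <= _); apply: eq_bigr => i _.
    rewrite !mxE; congr (_ * sawtooth (_ / _)); apply: eq_bigr => l _.
    by rewrite mxE.
  have b0 : 0 <= 2 / delta * (e / (1 - e)).
    by rewrite mulr_ge0// divr_ge0 ?subr_ge0 ?(ltW delta0) ?(ltW e0)// (le_trans e23)//; lra.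
  apply: le_trans (two_stage_error gram m0 delta0 cardx xlarge b0 t0 corr (xM w)) _.
  have A4 : 4 <= A.
    by apply: inv_sqr_half_ge4; rewrite mul1r powR_ge0 powR_half_lt.
  apply: (@le_trans _ _ (4 * (2 * norm2 x * expR (- (2 * pi ^+ 2 * norm2 x ^+ 2 / delta ^+ 2)) +
                 c7 * Num.sqrt (ln k%:R) * t * delta))); last first.
    by rewrite ler_wpM2r// addr_ge0// ?mulr_ge0 ?expR_ge0 ?invr_ge0 ?(ltW xpos) ?(ltW delta0) ?(ltW lnk).
  rewrite -[2 * pi ^+ 2 * norm2 x ^+ 2 / delta ^+ 2]mulrA -/e.
  rewrite /c7 divfK ?gt_eqF//.
  by apply: error_slack => //; [exact: ltW|rewrite e0].
- have mU : measurable (U1 `|` U2) by exact: measurableU.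
  rewrite probability_setC//.
  have PU : (P (U1 `|` U2) <= (nbad * bd)%:E)%E.
    apply: le_trans (measureU2 _ mU1 mU2) _.
    apply: le_trans (leeD PU1 PU2) _.
    rewrite -EFinD lee_fin /nbad natrD mulrDl.
    by rewrite /index_enum -!enumT -!cardE card_prod !card_ord.
  apply: (@le_trans _ _ (1 - nbad * bd)%:E); last by rewrite EFinB leeB.
  rewrite lee_fin lerD2l lerN2 /bd /c5.
  by rewrite mulrA ler_wpM2r ?expR_ge0// [nbad * 2]mulrC lerDl expR_ge0.
Qed.
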